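(* Let $t\ge2$ and let $R\in\mathrm{End}(V\otimes V)$ be the basic braided $R$-matrix of $U_{r,s}(\mathfrak{so}_{2n+1})$ given in the context. The Birman-Wenzl-Murakami algebra $\mathrm{BWM}_t(r^{-2n}s^{2n},r^{-1}s)$ admits a representation $\pi$ on $V^{\otimes t}$ such that $\pi(g_i)=R_{i,i+1}$ for $1\le i\le t-1$, where $R_{i,i+1}$ acts as $R$ in the $i$-th and $(i+1)$-th tensor factors and as the identity elsewhere.
   Context: Let $n\ge2$, $r,s$ algebraically independent, $\mathbb K\supseteq\mathbb Q(r,s)$ a field containing $\sqrt r,\sqrt s$. $\mathrm{BWM}_t(p,q)$ (with $p,q\neq0$, $q^2\ne1$) is the unital algebra over the ground field with invertible generators $g_1,\dots,g_{t-1}$ and relations $g_ig_{i+1}g_i=g_{i+1}g_ig_{i+1}$, $g_ig_j=g_jg_i$ for $|i-j|\ge2$, $e_ig_i=p^{-1}e_i$, $e_ig_{i-1}^{\pm1}e_i=p^{\pm1}e_i$, where $e_i$ is defined by $(q-q^{-1})(1-e_i)=g_i-g_i^{-1}$. $i'=2n+2-i$; $\rho_i=\frac{2n+1}2-i$ for $i\le n$, $\rho_{n+1}=0$, $\rho_{i'}=-\rho_i$; $V=\mathbb K^{2n+1}$, matrix units $E_{ij}$ ($E_{ij}v_j=v_i$); $A=\{(i,j):1\le i<j\le n\}\cup\{(i,j):2\le i\le n,(i-1)'\le j\le1'\}$, $B=\{(i,j):1\le i\le n-1,n'\le j\le(i+1)'\}\cup\{(i,j):n'\le i<j\le1'\}$;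 $R=r^{-1}s\sum_{i\ne i'}E_{ii}\otimes E_{ii}+r^{-1}s^{-1}(\sum_AE_{ij}\otimes E_{ji}+\sum_BE_{ji}\otimes E_{ij})+rs(\sum_AE_{ji}\otimes E_{ij}+\sum_BE_{ij}\otimes E_{ji})+\sum_{i\ne i'}(E_{i,n+1}\otimes E_{n+1,i}+E_{n+1,i}\otimes E_{i,n+1})+rs^{-1}\sum_{i\ne i'}E_{i'i}\otimes E_{ii'}+(r^{-1}s-rs^{-1})\{\sum_{i>j}E_{ii}\otimes E_{jj}-\sum_{i>j}(r^{-1}s)^{\rho_i-\rho_j}E_{ij'}\otimes E_{i'j}\}+E_{n+1,n+1}\otimes E_{n+1,n+1}$. *)

(* Defs.v *)
From HB Require Import structures.
From mathcomp Require Import all_boot all_order all_algebra generic_quotient.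
From mathcomp Require Import finmap boolp mxtens.
From mathcomp Require Import monalg.
From mathcomp Require mpoly.

Set Implicit Arguments.
Unset Strict Implicit.
Unset Printing Implicit Defensive.

Import GRing.Theory.
Local Open Scope ring_scope.
Local Open Scope quotient_scope.

Section AlgIndep.
Import mpoly.

(* Algebraic independence over Q, for K of characteristic 0 ([ratr] is the
   embedding of Q in K only in that case). *)
Definition alg_indep2 (K : fieldType) (x y : K) : Prop :=
  forall P : mpoly 2 rat, mmap (@ratr K) (tnth [tuple x; y]) P = 0 -> P = 0.

End AlgIndep.

Lemma malg_scaleAr (M : monomType) (R : comNzRingType) (a : R)
    (x y : {malg R[M]}) :
  a *: (x * y) = x * (a *: y).
Proof.
apply/malgP=> k; rewrite mcoeffZ mcoeffMl.
rewrite (mcoeffMlw k (fsubset_refl (msupp x)) (msuppZ_le a y)).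
rewrite mulr_sumr; apply: eq_bigr => k1 _.
rewrite mulr_sumr; apply: eq_bigr => k2 _.
by rewrite mcoeffZ mulrnAr mulrCA.
Qed.

Section BWM.
Variables (K : fieldType) (t : nat) (p q : K).

(* K<X>, X consisting of symbols [(true, i)] for g_i and [(false, i)] for its
   inverse. The index i : 'I_(t - 1) is 0-based: i stands for g_(i+1). *)
Definition bwm_free := {malg K[{fmonom (bool * 'I_t.-1)%type}]}.
HB.instance Definition _ := GRing.Lalgebra.on bwm_free.

Definition free_g (i : 'I_t.-1) : bwm_free := << fmu (true, i) >>%R.
Definition free_ginv (i : 'I_t.-1) : bwm_free := << fmu (false, i) >>%R.
Definition free_e (i : 'I_t.-1) : bwm_free :=
  1 - (q - q^-1)^-1 *: (free_g i - free_ginv i).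

Inductive bwm_rel : bwm_free -> bwm_free -> Prop :=
| bwm_rel_gV i : bwm_rel (free_g i * free_ginv i) 1
| bwm_rel_Vg i : bwm_rel (free_ginv i * free_g i) 1
| bwm_rel_braid (i j : 'I_t.-1) : j = i.+1 :> nat ->
    bwm_rel (free_g i * free_g j * free_g i) (free_g j * free_g i * free_g j)
| bwm_rel_far (i j : 'I_t.-1) : (i.+1 < j)%N || (j.+1 < i)%N ->
    bwm_rel (free_g i * free_g j) (free_g j * free_g i)
| bwm_rel_eg i : bwm_rel (free_e i * free_g i) (p^-1 *: free_e i)
| bwm_rel_ege (i j : 'I_t.-1) : i = j.+1 :> nat ->
    bwm_rel (free_e i * free_g j * free_e i) (p *: free_e i)
| bwm_rel_eVe (i j : 'I_t.-1) : i = j.+1 :> nat ->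
    bwm_rel (free_e i * free_ginv j * free_e i) (p^-1 *: free_e i).

Inductive bwm_ideal : bwm_free -> Prop :=
| bwm_ideal_rel x y : bwm_rel x y -> bwm_ideal (x - y)
| bwm_ideal0 : bwm_ideal 0
| bwm_idealD x y : bwm_ideal x -> bwm_ideal y -> bwm_ideal (x + y)
| bwm_idealMl a x : bwm_ideal x -> bwm_ideal (a * x)
| bwm_idealMr a x : bwm_ideal x -> bwm_ideal (x * a).

Definition bwm_equiv (x y : bwm_free) : bool := `[< bwm_ideal (x - y) >].

Lemma bwm_idealN x : bwm_ideal x -> bwm_ideal (- x).
Proof. by move=> Ix; rewrite -mulN1r; apply: bwm_idealMl. Qed.

Lemma bwm_equiv_refl : reflexive bwm_equiv.
Proof. by move=> x; apply/asboolP; rewrite subrr; apply: bwm_ideal0. Qed.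

Lemma bwm_equiv_sym : symmetric bwm_equiv.
Proof.
by move=> x y; apply/asboolP/asboolP => /bwm_idealN; rewrite opprB.
Qed.

Lemma bwm_equiv_trans : transitive bwm_equiv.
Proof.
move=> y x z /asboolP Ixy /asboolP Iyz; apply/asboolP.
by rewrite -(subrK y x) -addrA; apply: bwm_idealD.
Qed.

Canonical bwm_equivRel :=
  EquivRel bwm_equiv bwm_equiv_refl bwm_equiv_sym bwm_equiv_trans.

(* BWM_t(p, q), meant for p != 0, q != 0 and q ^+ 2 != 1. *)
Definition bwm := {eq_quot bwm_equiv}.
HB.instance Definition _ := Choice.on bwm.
HB.instance Definition _ := EqQuotient.on bwm.

Definition bwm_pi (x : bwm_free) : bwm := \pi_bwm x.

Lemma bwm_piP x y : bwm_ideal (x - y) <-> bwm_pi x = bwm_pi y.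
Proof.
split=> [Ixy | /eqmodP/asboolP //].
by apply/eqmodP/asboolP.
Qed.

Lemma bwm_piK (u : bwm) : bwm_pi (repr u) = u. Proof. exact: reprK. Qed.

Definition bwm_opp (u : bwm) := bwm_pi (- repr u).
Definition bwm_add (u v : bwm) := bwm_pi (repr u + repr v).
Definition bwm_mul (u v : bwm) := bwm_pi (repr u * repr v).
Definition bwm_scale (a : K) (u : bwm) := bwm_pi (a *: repr u).

Lemma bwm_repr x : bwm_ideal (repr (bwm_pi x) - x).
Proof. by apply/bwm_piP; rewrite bwm_piK. Qed.

Lemma bwm_piN x : bwm_opp (bwm_pi x) = bwm_pi (- x).
Proof. by apply/bwm_piP; rewrite -opprD; apply/bwm_idealN/bwm_repr. Qed.

Lemma bwm_piD x y : bwm_add (bwm_pi x) (bwm_pi y) = bwm_pi (x + y).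
Proof.
apply/bwm_piP; rewrite opprD addrACA.
by apply: bwm_idealD; apply: bwm_repr.
Qed.

Lemma bwm_piM x y : bwm_mul (bwm_pi x) (bwm_pi y) = bwm_pi (x * y).
Proof.
apply/bwm_piP; rewrite -(subrK (x * repr (bwm_pi y)) (_ * _)) -addrA.
rewrite -mulrBl -mulrBr.
by apply: bwm_idealD; [apply: bwm_idealMr | apply: bwm_idealMl];
  apply: bwm_repr.
Qed.

Lemma bwm_piZ a x : bwm_scale a (bwm_pi x) = bwm_pi (a *: x).
Proof.
apply/bwm_piP; rewrite -scalerBr -[_ - x]mul1r scalerAl.
exact/bwm_idealMl/bwm_repr.
Qed.

Let bwm_ind (P : bwm -> Prop) : (forall x, P (bwm_pi x)) -> forall u, P u.
Proof. by move=> Ppi u; rewrite -[u]bwm_piK. Qed.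

Fact bwm_addA : associative bwm_add.
Proof.
elim/bwm_ind=> x; elim/bwm_ind=> y; elim/bwm_ind=> z.
by rewrite !bwm_piD addrA.
Qed.

Fact bwm_addC : commutative bwm_add.
Proof. by elim/bwm_ind=> x; elim/bwm_ind=> y; rewrite !bwm_piD addrC. Qed.

Fact bwm_add0 : left_id (bwm_pi 0) bwm_add.
Proof. by elim/bwm_ind=> x; rewrite bwm_piD add0r. Qed.

Fact bwm_addN : left_inverse (bwm_pi 0) bwm_opp bwm_add.
Proof. by elim/bwm_ind=> x; rewrite bwm_piN bwm_piD addNr. Qed.

HB.instance Definition _ :=
  GRing.isZmodule.Build bwm bwm_addA bwm_addC bwm_add0 bwm_addN.

Lemma bwm_pi_is_additive : {morph bwm_pi : x y / x + y}.
Proof. by move=> x y; exact/esym/bwm_piD. Qed.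

Fact bwm_mulA : associative bwm_mul.
Proof.
elim/bwm_ind=> x; elim/bwm_ind=> y; elim/bwm_ind=> z.
by rewrite !bwm_piM mulrA.
Qed.

Fact bwm_mul1 : left_id (bwm_pi 1) bwm_mul.
Proof. by elim/bwm_ind=> x; rewrite bwm_piM mul1r. Qed.

Fact bwm_mulr1 : right_id (bwm_pi 1) bwm_mul.
Proof. by elim/bwm_ind=> x; rewrite bwm_piM mulr1. Qed.

Fact bwm_mulDl : left_distributive bwm_mul bwm_add.
Proof.
elim/bwm_ind=> x; elim/bwm_ind=> y; elim/bwm_ind=> z.
by rewrite !(bwm_piD, bwm_piM) mulrDl.
Qed.

Fact bwm_mulDr : right_distributive bwm_mul bwm_add.
Proof.
elim/bwm_ind=> x; elim/bwm_ind=> y; elim/bwm_ind=> z.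
by rewrite !(bwm_piD, bwm_piM) mulrDr.
Qed.

HB.instance Definition _ :=
  GRing.Zmodule_isPzRing.Build bwm
    bwm_mulA bwm_mul1 bwm_mulr1 bwm_mulDl bwm_mulDr.

Lemma bwm_pi_is_multiplicative : {morph bwm_pi : x y / x * y}.
Proof. by move=> x y; exact/esym/bwm_piM. Qed.

Fact bwm_scaleA a b (u : bwm) :
  bwm_scale a (bwm_scale b u) = bwm_scale (a * b) u.
Proof. by elim/bwm_ind: u => x; rewrite !bwm_piZ scalerA. Qed.

Fact bwm_scale1 : left_id 1 bwm_scale.
Proof. by elim/bwm_ind=> x; rewrite bwm_piZ scale1r. Qed.

Fact bwm_scaleDr : right_distributive bwm_scale +%R.
Proof.
move=> a; elim/bwm_ind=> x; elim/bwm_ind=> y.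
by rewrite -bwm_pi_is_additive !bwm_piZ -bwm_pi_is_additive scalerDr.
Qed.

Fact bwm_scaleDl u : {morph bwm_scale^~ u : a b / a + b}.
Proof.
elim/bwm_ind: u => x a b.
by rewrite !bwm_piZ -bwm_pi_is_additive scalerDl.
Qed.

HB.instance Definition _ :=
  GRing.Zmodule_isLmodule.Build K bwm
    bwm_scaleA bwm_scale1 bwm_scaleDr bwm_scaleDl.

Lemma bwm_pi_is_scalable : scalable bwm_pi.
Proof. by move=> a x; exact/esym/bwm_piZ. Qed.

(* The library's [algType] requires 1 != 0; these two lemmas complete the
   K-algebra axioms without that requirement. *)
Lemma bwm_scaleAl a (u v : bwm) : a *: (u * v) = (a *: u) * v.
Proof.
elim/bwm_ind: u => x; elim/bwm_ind: v => y.
rewrite -bwm_pi_is_multiplicative -!bwm_pi_is_scalable.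
by rewrite -bwm_pi_is_multiplicative scalerAl.
Qed.

Lemma bwm_scaleAr a (u v : bwm) : a *: (u * v) = u * (a *: v).
Proof.
elim/bwm_ind: u => x; elim/bwm_ind: v => y.
rewrite -bwm_pi_is_multiplicative -!bwm_pi_is_scalable.
by rewrite -bwm_pi_is_multiplicative malg_scaleAr.
Qed.

Definition bwm_g (i : 'I_t.-1) : bwm := bwm_pi (free_g i).

End BWM.

Section RMatrix.
Variables (n : nat) (K : fieldType) (r s sr ss : K).

Local Notation N := (2 * n).+1.

(* 'I_N is 0-based: the 1-based index of i : 'I_N is i + 1, and i' = 2n + 2 - i
   is then [rev_ord]. The functions below on nat use 1-based indices. *)
Local Notation "i ^'" := (rev_ord i).

Definition prime_index (k : nat) : nat := (2 * n + 2 - k)%N.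

Definition in_A (i j : nat) : bool :=
  [&& 1 <= i, i < j & j <= n]%N ||
  [&& 2 <= i, i <= n, prime_index i.-1 <= j & j <= prime_index 1]%N.

Definition in_B (i j : nat) : bool :=
  [&& 1 <= i, i <= n.-1, prime_index n <= j & j <= prime_index i.+1]%N ||
  [&& prime_index n <= i, i < j & j <= prime_index 1]%N.

(* 2 rho_k *)
Definition double_rho (k : nat) : int :=
  if (k <= n)%N then (2 * n).+1%:Z - (2 * k)%:Z
  else if k == n.+1 then 0
  else - ((2 * n).+1%:Z - (2 * prime_index k)%:Z).

(* (r^-1 s)^(rho_i - rho_j), where sr and ss are the square roots of r and s *)
Definition q_rho (i j : nat) : K :=
  (sr^-1 * ss) ^ (double_rho i - double_rho j).

Lemma mid_subproof : (n < N)%N.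
Proof. by rewrite ltnS leq_pmull. Qed.

(* the index n + 1 *)
Definition mid : 'I_N := Ordinal mid_subproof.

(* Matrices act on column vectors: E i j maps the basis vector j to i. *)
Local Notation E := (@delta_mx K N N).

Definition Rmat : 'M[K]_(N * N) :=
  (r^-1 * s) *: (\sum_(i < N | i != i^') E i i *t E i i)
  + (r^-1 * s^-1) *:
      (\sum_(i < N) \sum_(j < N | in_A i.+1 j.+1) E i j *t E j i
       + \sum_(i < N) \sum_(j < N | in_B i.+1 j.+1) E j i *t E i j)
  + (r * s) *:
      (\sum_(i < N) \sum_(j < N | in_A i.+1 j.+1) E j i *t E i j
       + \sum_(i < N) \sum_(j < N | in_B i.+1 j.+1) E i j *t E j i)
  + \sum_(i < N | i != i^') (E i mid *t E mid i + E mid i *t E i mid)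
  + (r * s^-1) *: (\sum_(i < N | i != i^') E i^' i *t E i i^')
  + (r^-1 * s - r * s^-1) *:
      (\sum_(i < N) \sum_(j < N | (j < i)%N) E i i *t E j j
       - \sum_(i < N) \sum_(j < N | (j < i)%N)
           q_rho i.+1 j.+1 *: (E i j^' *t E i^' j))
  + E mid mid *t E mid mid.

End RMatrix.

Lemma two_site_subproof N t (i : 'I_t.-1) :
  (N ^ i * (N * N) * N ^ (t - i.+2) = N ^ t)%N.
Proof.
have ti : (i.+2 <= t)%N by case: t i => [|[|t]] [].
by rewrite mulnn -!expnD addn2 subnKC.
Qed.

(* For V of dimension N, End(V^{\otimes t}) is 'M_(N ^ t), with the Kronecker
   product as tensor product. With 0-based i, this is A acting in the tensor
   factors i + 1 and i + 2. *)
Definition two_site (K : fieldType) (N t : nat) (A : 'M[K]_(N * N))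
    (i : 'I_t.-1) : 'M[K]_(N ^ t) :=
  castmx (two_site_subproof N i, two_site_subproof N i)
    ((1%:M : 'M[K]_(N ^ i)) *t A *t (1%:M : 'M[K]_(N ^ (t - i.+2)))).

(* Main.v *)
Require Import Defs.
From HB Require Import structures.
From mathcomp Require Import all_boot all_order all_algebra zify ring mxtens.
From mathcomp Require Import monalg.
From mathcomp Require mpoly.

Set Implicit Arguments.
Unset Strict Implicit.
Unset Printing Implicit Defensive.

Import GRing.Theory.
Local Open Scope ring_scope.

(** With q = r^-1 s, lam = q - q^-1, weights h_a = q^(rho_a) (so that
    h_a h_(a') = 1) and suitable w(a, b), the matrix R acts on coordinates by
      (R f)(a, b) = w(a, b) f(b, a) + [b < a] lam f(a, b)
                    - [b = a'] lam h_a sum_(j < a) h_(j') f(j', j),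
    and e = K := psi phi, where phi = psi^T has coefficient h_a on v_a (x) v_a'.
    Telescoping sums of the h_a^2 give phi R = p^-1 phi and the inverse
    V = R - lam + lam K of R. A termwise comparison gives
    phi_12 R_23 = phi_23 V_12, from which the other crossing relations follow
    by the zigzag identities and by transposition; they give e_i g_(i-1) e_i.

    For the braid relation put D = R_12 R_23 R_12 - R_23 R_12 R_23. The crossing
    relations give phi_12 D = 0 = phi_23 D and then (R_12 - lam) D = - D R_23 and
    (R_23 - lam) D = - D R_12. Hence vanishing of rows of D propagates from the
    rows (a, b, c) with a <= b <= c to all rows, and on these rows D = 0 is a
    short computation without any geometric sum. *)

(** * The operator R on coordinates *)

Lemma val_rev_ord N (i : 'I_N) : rev_ord i = (N - i.+1)%N :> nat.
Proof. by []. Qed.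

Local Opaque rev_ord.

(** Linear arithmetic on ordinals: the bounds of all indices in the context are added, and the
    reversal becomes the truncated difference N - (i + 1). *)
Ltac ord_lia :=
  repeat match goal with
  | i : 'I_?N |- _ => lazymatch goal with
                     | _ : is_true (nat_of_ord i < _)%N |- _ => fail
                     | _ => let H := fresh in pose proof (ltn_ord i) as H
                     end
  end;
  repeat match goal with
  | H : is_true (@eq_op _ (_ : 'I_ _) _) |- _ => revert H
  | H : is_true (negb (@eq_op _ (_ : 'I_ _) _)) |- _ => revert H
  | H : is_true (_ <= _)%N |- _ => revert H
  end;
  rewrite ?rev_ordK; repeat rewrite -val_eqE; simpl; rewrite ?val_rev_ord; lia.

Section FunctionalR.
Variables (K : fieldType) (N : nat) (q : K) (h : 'I_N -> K).
Implicit Types (w : 'I_N -> 'I_N -> K) (a b c i j k : 'I_N).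
Local Notation "i ^'" := (rev_ord i).
Local Notation "i ^'" := (rev_ord i) : nat_scope.
Local Notation lam := (q - q^-1).

(* [w a b] is the coefficient of v_a (x) v_b in R (v_b (x) v_a). *)
Record weight_axioms w : Prop := WeightAxioms {
  w_inv : forall a b, a != b -> a != b^' -> w a b * w b a = 1;
  w_revl : forall a b, a != b -> a != b^' -> w a^' b = w b a;
  w_revr : forall a b, a != b -> a != b^' -> w a b^' = w b a;
  w_diag : forall a, a != a^' -> w a a = q;
  w_opp : forall a, a != a^' -> w a a^' = q^-1;
  w_mid : forall a, a = a^' -> w a a = 1 }.

(** The transpose of R is R with transposed weights, so this stability lets relations on caps be
    transposed into relations on cups. *)
Lemma weight_axiomsT w : weight_axioms w -> weight_axioms (fun a b => w b a).
Proof.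
move=> W; split=> [a b ab abr|a b ab abr|a b ab abr|a ar|a ar|a ar].
- by apply: (w_inv W); ord_lia.
- by rewrite (w_revr W) //; ord_lia.
- by rewrite (w_revl W) //; ord_lia.
- exact: (w_diag W).
- by rewrite -{2}[a]rev_ordK; apply: (w_opp W); rewrite rev_ordK eq_sym.
- exact: (w_mid W).
Qed.

Hypothesis q_neq0 : q != 0.
Hypothesis h_rev : forall a, h a * h a^' = 1.

Lemma h_revl a : h a^' * h a = 1.
Proof. by rewrite mulrC h_rev. Qed.

Definition Rop w (f : 'I_N -> 'I_N -> K) a b : K :=
  w a b * f b a + (if (b < a)%N then lam * f a b else 0)
  - (if b == a^' then lam * h a * \sum_(j < N | (j < a)%N) h j^' * f j^' j
     else 0).

Definition cap (f : 'I_N -> 'I_N -> K) : K := \sum_a h a * f a a^'.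

(** The relation defining e_i forces g_i^-1 = g_i - lam + lam e_i; this is the right side with K for
    e_i. *)
Definition Rvop w (f : 'I_N -> 'I_N -> K) a b : K :=
  Rop w f a b - lam * f a b + (if b == a^' then lam * (h a * cap f) else 0).

Lemma cap_rev f : cap f = \sum_j h j^' * f j^' j.
Proof.
rewrite /cap (reindex_inj rev_ord_inj) /=.
by apply: eq_bigr => j _; rewrite rev_ordK.
Qed.

(** Removing from the whole cap its part below [a] leaves the part from [a] on: V has the shape of R
    with complementary index ranges and opposite signs of lam. *)
Lemma RvopE w f a b : Rvop w f a b =
  w a b * f b a - (if (a <= b)%N then lam * f a b else 0)
  + (if b == a^' then lam * h a * \sum_(j < N | (a <= j)%N) h j^' * f j^' j
     else 0).
Proof.
have -> : \sum_(j < N | (a <= j)%N) h j^' * f j^' j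
    = cap f - \sum_(j < N | (j < a)%N) h j^' * f j^' j.
  rewrite cap_rev [in RHS](bigID (fun j : 'I_N => (j < a)%N)) /= [RHS]addrC addKr.
  by apply: eq_bigl => j; rewrite -leqNgt.
rewrite /Rvop /Rop.
by case: (leqP a b) => _; case: eqP => _; ring.
Qed.

(** * The crossing relation between cap and braiding *)

Section Naturality.
Variable w : 'I_N -> 'I_N -> K.
Hypothesis W : weight_axioms w.

(** The right side is the boundary discrepancy met in [cap_cross], where strict ranges coming from R
    face weak ranges coming from V. *)
Lemma w_skein b c :
  w c b - w b^' c = lam * ((b == c)%:R - (b == c^')%:R).
Proof.
case: (eqVneq b c) => [->|bc].
  case: (eqVneq c c^') => [E|E].
    by rewrite -E (w_mid W E) !subrr mulr0.
  rewrite (w_diag W E) -{2}[c]rev_ordK (w_opp W) ?rev_ordK 1?eq_sym //.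
  by rewrite subr0 mulr1.
case: (eqVneq b c^') bc => [->|bcr] bc; last by rewrite (w_revl W) // !subrr mulr0.
have E : c != c^' by rewrite eq_sym.
by rewrite rev_ordK (w_opp W) // (w_diag W) // mulr0n mulr1n; ring.
Qed.

(** This is phi_12 R_23 = phi_23 V_12. The cup part of each side matches the diagonal part of the
    other, up to one boundary term at b = c and one at b = c'; [w_skein] finds these in the
    permutation part. *)
Lemma cap_cross (f : 'I_N -> 'I_N -> 'I_N -> K) c :
  \sum_a h a * Rop w (f a) a^' c
  = \sum_b h b * Rvop w (fun i j => f i j b^') c b.
Proof.
under eq_bigr do rewrite /Rop !mulrDr mulrN.
under [RHS]eq_bigr do rewrite RvopE !mulrDr mulrN.
rewrite !big_split /= !sumrN.
(* The cup part is met by a = c only, where the outer weights cancel because h_c h_c' = 1. *)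
have -> : \sum_a h a * (if c == (a^')^' then
       lam * h a^' * \sum_(j < N | (j < a^')%N) h j^' * f a j^' j else 0)
  = \sum_(b < N | (c < b)%N) lam * (h b * f c b b^').
  rewrite (bigD1 c) //= rev_ordK eqxx [X in _ + X]big1 ?addr0 => [|a ac]; last first.
    by rewrite rev_ordK eq_sym (negPf ac) mulr0.
  rewrite mulrCA mulrA -[lam * _ * _]mulrA h_revl mulr1 mulr_sumr.
  rewrite (reindex_inj rev_ord_inj) /=; apply: eq_big => [b|b _].
    by ord_lia.
  by rewrite rev_ordK.
have -> : \sum_b h b * (if b == c^' then
       lam * h c * \sum_(j < N | (c <= j)%N) h j^' * f j^' j b^' else 0)
  = \sum_(a < N | (c <= a^')%N) lam * (h a * f a a^' c).
  rewrite (bigD1 c^') //= eqxx [X in _ + X]big1 ?addr0 => [|b /negPf ->]; last first.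
    by rewrite mulr0.
  rewrite mulrCA mulrA -[lam * _ * _]mulrA h_rev mulr1 mulr_sumr.
  rewrite [RHS](reindex_inj rev_ord_inj) /=; apply: eq_big => [b|b _].
    by ord_lia.
  by rewrite !rev_ordK.
rewrite (big_mkcond (fun b : 'I_N => (_ < _)%N)).
rewrite (big_mkcond (fun b : 'I_N => (_ <= _)%N)) /=.
rewrite -!sumrN -!big_split /=; apply: eq_bigr => b _.
(* The summands involve f(b, c, b'), f(c, b, b') and f(b, b', c). The first equals the second at b =
   c and the third at b = c', which is where the ranges differ. *)
have wE : w b^' c = w c b - lam * ((b == c)%:R - (b == c^')%:R).
  by rewrite -w_skein opprB addrC subrK.
rewrite wE.
case: (eqVneq b c) => [->|bc].
  case: (eqVneq c c^') => [/eqP E|E].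
    have -> : (c < c^')%N = false by ord_lia.
    have -> : (c <= c^')%N by ord_lia.
    rewrite -(eqP E) ltnn leqnn mulr1n; ring.
  rewrite ltnn leqnn mulr0n mulr1n.
  have -> : (c < c^')%N = (c <= c^')%N by ord_lia.
  case: ifP => _; ring.
case: (eqVneq b c^') bc => [->|bcr] bc.
  rewrite rev_ordK mulr0n mulr1n.
  have -> : (c < c)%N = false by ord_lia.
  have -> : (c <= c)%N by ord_lia.
  have -> : (c < c^')%N = (c <= c^')%N by ord_lia.
  case: ifP => _; ring.
have -> : (c < b^')%N = (c <= b^')%N by ord_lia.
have -> : (c < b)%N = (c <= b)%N by ord_lia.
rewrite !mulr0n; case: ifP => _; case: ifP => _; ring.
Qed.
End Naturality.

(** * The eigenvalue of the cap and the inverse of R *)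

Section Inverse.
Variables (w : 'I_N -> 'I_N -> K) (pinv : K).
Hypothesis W : weight_axioms w.
Hypothesis h_sum : forall j,
  lam * (\sum_(a < N | (j < a)%N) h a ^+ 2)
  = w j j^' * h j ^+ 2 + (if (j < j^')%N then lam else 0) - pinv.

(** The coefficient of h_a f(a, a') collects a permutation, a diagonal and a cup contribution, and
    [h_sum] at a' says that they add up to [pinv]. *)
Lemma cap_Rop f : cap (Rop w f) = pinv * cap f.
Proof.
rewrite /cap /Rop.
under eq_bigr do rewrite eqxx mulrBr mulrDr.
rewrite sumrB big_split /=.
have -> : \sum_a h a * (w a a^' * f a^' a)
    = \sum_a h a^' * (w a^' a * f a a^').
  rewrite (reindex_inj rev_ord_inj) /=.
  by apply: eq_bigr => a _; rewrite rev_ordK.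
have -> : \sum_a h a * (lam * h a * \sum_(j < N | (j < a)%N) h j^' * f j^' j)
  = \sum_a (lam * \sum_(b < N | (a^' < b)%N) h b ^+ 2) * (h a * f a a^').
  rewrite [RHS](reindex_inj rev_ord_inj) /=.
  under eq_bigr do rewrite mulr_sumr mulr_sumr big_mkcond.
  rewrite exchange_big /=; apply: eq_bigr => j _.
  rewrite rev_ordK mulr_sumr mulr_suml [RHS]big_mkcond /=.
  apply: eq_bigr => b _.
  by case: ifP => _ //; ring.
rewrite -big_split -sumrB mulr_sumr /=; apply: eq_bigr => a _.
rewrite h_sum rev_ordK.
have -> : h a^' = h a^' ^+ 2 * h a by rewrite expr2 -mulrA h_revl mulr1.
case: ifP => _; ring: (h_revl a).
Qed.

(** A truncated cap applied to V, as met by the cup part of R in [RopK]. The finite sums of h^2 come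
    from subtracting [h_sum] at k from [h_sum] at a', which eliminates [pinv]. *)
Lemma sum_Rvop f a :
  \sum_(j < N | (j < a)%N) h j^' * Rvop w f j^' j
  = w a^' a * h a^' ^+ 2 * (\sum_(k < N | (a^' <= k)%N) h k^' * f k^' k)
    - w a^' a * h a^' * f a a^'
    + (if (a^' < a)%N then
         lam * \sum_(k < N | (a <= k)%N) h k^' * f k^' k else 0).
Proof.
have sumE k : (a^' <= k)%N ->
    lam * (\sum_(j < N | (j < a)%N && (j^' <= k)%N) h j^' ^+ 2)
    = w a^' a * h a^' ^+ 2 + (if (a^' < a)%N then lam else 0)
      - w k k^' * h k ^+ 2 - (if (k < k^')%N then lam else 0).
  move=> ak; have := h_sum a^'; rewrite rev_ordK.
  rewrite (bigID (fun i : 'I_N => (i <= k)%N)) /= mulrDr.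
  have -> : \sum_(i < N | (a^' < i)%N && ~~ (i <= k)%N) h i ^+ 2
          = \sum_(i < N | (k < i)%N) h i ^+ 2.
    by apply: eq_bigl => i; move: ak; ord_lia.
  have -> : \sum_(j < N | (j < a)%N && (j^' <= k)%N) h j^' ^+ 2
          = \sum_(i < N | (a^' < i)%N && (i <= k)%N) h i ^+ 2.
    rewrite [RHS](reindex_inj rev_ord_inj) /=.
    by apply: eq_bigl => i; ord_lia.
  rewrite h_sum => /(canRL (addrK _)) ->; by do 2!case: ifP => _; ring.
have -> : \sum_(j < N | (j < a)%N) h j^' * Rvop w f j^' j
  = \sum_(k < N | (a^' < k)%N) w k k^' * h k ^+ 2 * (h k^' * f k^' k)
    - \sum_(k < N | (k < a)%N && (k^' <= k)%N) lam * (h k^' * f k^' k)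
    + \sum_(k < N | (a^' <= k)%N)
       (w a^' a * h a^' ^+ 2 + (if (a^' < a)%N then lam else 0)
      - w k k^' * h k ^+ 2 - (if (k < k^')%N then lam else 0))
         * (h k^' * f k^' k).
  under eq_bigr do rewrite RvopE rev_ordK eqxx mulrDr mulrBr.
  rewrite !big_split /= sumrN; congr (_ - _ + _).
  - rewrite [RHS](reindex_inj rev_ord_inj) /=.
    apply: eq_big => j; first by ord_lia.
    rewrite rev_ordK => _; ring: (h_revl j).
  - rewrite big_mkcondr /=; apply: eq_bigr => j _.
    by case: ifP => _; ring.
  - under eq_bigr do rewrite mulrA mulr_sumr big_mkcond /=.
    rewrite exchange_big /= [RHS]big_mkcond /=; apply: eq_bigr => k _.
    case: ifP => ak.
      rewrite -(sumE k ak) mulr_sumr mulr_suml -big_mkcondr /=.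
      by apply: eq_bigr => j _; ring.
    rewrite big1 // => j ja; case: ifP => // jk.
    by move: ak ja jk; ord_lia.
rewrite [X in w a^' a * h a^' * X](_ : _ = h a^' * (h a * f a a^')); last first.
  by rewrite mulrA h_revl mul1r.
(* The subtracted term is the one of index k = a' absent from the strict range a' < k. Written as a
   sum, it allows a comparison for each k separately. *)
have -> : w a^' a * h a^' * (h a^' * (h a * f a a^')) =
    \sum_k (if k == a^' then w k k^' * h k ^+ 2 * (h k^' * f k^' k) else 0).
  by rewrite -big_mkcond big_pred1_eq rev_ordK; ring.
have -> : (if (a^' < a)%N then
         lam * \sum_(k < N | (a <= k)%N) h k^' * f k^' k else 0)
  = \sum_(k < N | (a <= k)%N)
      (if (a^' < a)%N then lam * (h k^' * f k^' k) else 0).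
  by case: ifP => _; rewrite ?mulr_sumr // big1.
rewrite mulr_sumr [X in X - _ + _ = _]big_mkcond [X in _ - X + _ = _]big_mkcond.
rewrite [X in _ + X = _]big_mkcond [X in _ = X - _ + _]big_mkcond.
rewrite [X in _ = _ + X]big_mkcond /=.
rewrite -!sumrN -!big_split /=; apply: eq_bigr => k _.
case: (eqVneq k a^') => [->|ka].
  rewrite ltnn leqnn rev_ordK.
  have -> : (a^' < a)%N && (a <= a^')%N = false by ord_lia.
  have -> : (a <= a^')%N = ~~ (a^' < a)%N by ord_lia.
  by case: (a^' < a)%N => /=; ring.
have -> : (a^' <= k)%N = (a^' < k)%N by ord_lia.
have -> : (k < a)%N && (k^' <= k)%N = (k < a)%N && ~~ (k < k^')%N by ord_lia.
case: (ltnP a^' k) => ak; case: (ltnP k k^') => kk; case: (ltnP k a) => ka';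
  case: (ltnP a^' a) => aa; rewrite ?leqNgt ?ka' /=;
  first [ring | by exfalso; ord_lia].
Qed.

(** Only the rows with b = a' involve cups, and [sum_Rvop] handles them. Elsewhere R and V act by
    inverse blocks on the pair (a, b), (b, a), or by q and q^-1 when a = b. *)
Lemma RopK f a b : Rop w (Rvop w f) a b = f a b.
Proof.
rewrite {1}/Rop.
case: eqP => [->|/eqP ba].
  rewrite sum_Rvop !RvopE rev_ordK !eqxx.
  set S1 := \sum_(j < N | (a^' <= j)%N) _; set S2 := \sum_(j < N | (a <= j)%N) _.
  have -> : lam * h a * (w a^' a * h a^' ^+ 2 * S1 - w a^' a * h a^' * f a a^' +
     (if (a^' < a)%N then lam * S2 else 0))
    = lam * w a^' a * h a^' * S1 - lam * w a^' a * f a a^'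
      + (if (a^' < a)%N then lam * h a * lam * S2 else 0).
    by case: ifP => _; ring: (h_rev a).
  case: (eqVneq a a^') => [E|E].
    have -> : w a a^' = 1 by rewrite -E (w_mid W).
    have -> : w a^' a = 1 by rewrite -E (w_mid W).
    by rewrite -E ltnn leqnn; ring.
  have wa : w a^' a = q^-1.
    by rewrite -{2}[a]rev_ordK (w_opp W) ?rev_ordK 1?eq_sym.
  rewrite (w_opp W) // wa.
  have -> : (a^' <= a)%N = (a^' < a)%N by ord_lia.
  have -> : (a <= a^')%N = ~~ (a^' < a)%N by ord_lia.
  by case: ifP => _ /=; field.
have ab : a == b^' = false by ord_lia.
rewrite !RvopE ab (negPf ba) subr0 !addr0.
case: (eqVneq a b) ba ab => [<-|nab] ba ab.
  by rewrite ltnn leqnn (w_diag W) //=; field.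
have -> : (a <= b)%N = ~~ (b < a)%N by ord_lia.
have -> : (b <= a)%N = (b < a)%N by ord_lia.
have ww : w a b * w b a = 1 by apply: (w_inv W); rewrite ?nab ?ab.
by case: ifP => _ /=; ring: ww.
Qed.

End Inverse.
End FunctionalR.

(** * Rows of the braid defect *)

Section Braid.
Variables (K : fieldType) (N : nat) (q : K) (h : 'I_N -> K).
Variable w : 'I_N -> 'I_N -> K.
Implicit Types (a b c i j k : 'I_N).
Local Notation "i ^'" := (rev_ord i).
Local Notation "i ^'" := (rev_ord i) : nat_scope.
Local Notation lam := (q - q^-1).

Hypothesis q_neq0 : q != 0.
Hypothesis h_rev : forall a, h a * h a^' = 1.
Hypothesis W : weight_axioms q w.
Local Notation Rw := (Rop q h w).

Implicit Type f : 'I_N -> 'I_N -> 'I_N -> K.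

Definition Rop12 f a b c := Rw (fun i j => f i j c) a b.
Definition Rop23 f a b c := Rw (f a) b c.

Lemma Rop_le (f : 'I_N -> 'I_N -> K) a b : (a <= b)%N -> Rw f a b =
  w a b * f b a
  - (if b == a^' then lam * h a * \sum_(j < N | (j < a)%N) h j^' * f j^' j
     else 0).
Proof. by move=> ab; rewrite /Rop ltnNge ab addr0. Qed.

Lemma Rop_lt_off (f : 'I_N -> 'I_N -> K) a b : (a <= b)%N -> b != a^' ->
  Rw f a b = w a b * f b a.
Proof. by move=> ab ba; rewrite Rop_le // (negPf ba) subr0. Qed.

Lemma Rop_off (f : 'I_N -> 'I_N -> K) a b : b != a^' ->
  Rw f a b = w a b * f b a + (if (b < a)%N then lam * f a b else 0).
Proof. by move=> /negPf ba; rewrite /Rop ba subr0. Qed.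

(** The value that the permutation part of the outer R_12 picks up in row (a, b, c) of R_12 R_23
    R_12. *)
Lemma Rop2312_sorted f a b c : (a <= b)%N -> (b <= c)%N ->
  Rop23 (Rop12 f) b a c = w a c * (w b c * f c b a
     - (if c == b^' then lam * h b * \sum_(j < N | (j < b)%N) h j^' * f j^' j a
        else 0))
  - (if c == a^' then
       lam * h a * \sum_(j < N | (j < a)%N) h j^' * (w j b * f j^' b j) else 0).
Proof.
move=> ab bc; rewrite /Rop23 Rop_le ?(leq_trans ab) // /Rop12 Rop_le //.
congr (_ - _); case: eqP => // /eqP ca; congr (_ * _).
apply: eq_bigr => j ja; congr (_ * _).
rewrite Rop_lt_off ?(w_revr W) //; ord_lia.
Qed.

(** The values picked up by the cup part of the outer R_12, present when b = a'. The weights w(j, c)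
    and w(j', c) are mutually inverse, also when c = j'. *)
Lemma Rop2312_pair f a b c j : b == a^' -> (a <= b)%N -> (b <= c)%N -> (j < a)%N ->
  Rop23 (Rop12 f) j^' j c = f c j^' j
    + (if (j < c^')%N then lam * (w j c * f j^' c j) else 0)
  - (if j == c^' then
     lam * h j * \sum_(k < N | (k < j)%N) h k^' * (w k c * f k^' c k) else 0).
Proof.
move=> ba ab bc ja; rewrite /Rop23 Rop_le; last by ord_lia.
rewrite /Rop12 Rop_off; last by ord_lia.
have -> : (j == c^') = (c == j^') by ord_lia.
have -> : (j < c^')%N = (c < j^')%N by ord_lia.
have jc : j != c by ord_lia.
congr (_ - _).
  rewrite mulrDr mulrA; congr (_ + _); last by case: ifP => _; rewrite ?mulr0; ring.
  case: (eqVneq c j^') => [->|cj].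
    rewrite (w_opp W) ?(w_diag W) ?mulVf ?mul1r //; ord_lia.
  by rewrite (w_revl W) ?(w_inv W) ?mul1r //; ord_lia.
case: eqP => // /eqP cj; congr (_ * _); apply: eq_bigr => k kj; congr (_ * _).
rewrite Rop_lt_off; [|by ord_lia..].
by rewrite -(eqP cj) (w_revr W) //; ord_lia.
Qed.

(** The counterparts for the outer R_23 of R_23 R_12 R_23: first its permutation part, then, in
    [Rop1223_pair], its cup part. *)
Lemma Rop1223_sorted f a b c : (a <= b)%N -> (b <= c)%N ->
  Rop12 (Rop23 f) a c b = w a c * (w a b * f c b a
     - (if b == a^' then lam * h a * \sum_(j < N | (j < a)%N) h j^' * f c j^' j
        else 0))
  - (if c == a^' then
       lam * h a * \sum_(j < N | (j < a)%N) h j^' * (w j b * f j^' b j) else 0).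
Proof.
move=> ab bc; rewrite /Rop12 Rop_le ?(leq_trans ab) // /Rop23 Rop_le //.
congr (_ - _); case: eqP => // /eqP ca; congr (_ * _).
apply: eq_bigr => j ja; congr (_ * _).
rewrite Rop_lt_off //; ord_lia.
Qed.

Lemma Rop1223_pair f a b c j : c == b^' -> (a <= b)%N -> (b <= c)%N -> (j < b)%N ->
  Rop12 (Rop23 f) a j^' j = f j^' j a
    + (if (j < a)%N then lam * (w j a * f j^' a j) else 0)
  - (if j == a then
     lam * h a * \sum_(k < N | (k < a)%N) h k^' * (w k a * f k^' a k) else 0).
Proof.
move=> cb ab bc jb; rewrite /Rop12 Rop_le; last by ord_lia.
rewrite /Rop23 Rop_off; last by ord_lia.
rewrite (inj_eq rev_ord_inj).
congr (_ - _).
  rewrite mulrDr mulrA; congr (_ + _).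
    case: (eqVneq j a) => [<-|ja].
      rewrite (w_opp W) ?(w_diag W) ?mulVf ?mul1r //; ord_lia.
    rewrite (w_revr W) ?(w_inv W) ?mul1r //; ord_lia.
  case: ifP => ja; rewrite ?mulr0 // (w_revr W); [by ring | by ord_lia..].
case: eqP => // ->; congr (_ * _); apply: eq_bigr => k kj; congr (_ * _).
by rewrite Rop_lt_off //; ord_lia.
Qed.

(** The outer factors have no diagonal part on sorted rows, and nested cup sums collapse by h_j h_j'
    = 1. The rest depends only on which of c = b', c = a' and b = a' hold. *)
Lemma braid_sorted f a b c : (a <= b)%N -> (b <= c)%N ->
  Rop12 (Rop23 (Rop12 f)) a b c = Rop23 (Rop12 (Rop23 f)) a b c.
Proof.
move=> ab bc; rewrite {1}/Rop12 Rop_le // [in RHS]/Rop23 Rop_le //.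
rewrite Rop2312_sorted // Rop1223_sorted //.
(* The nested cup row occurs only for j = c'. If c' < a, then j = c' lies in the range and that row
   cancels the diagonal contribution, by h_c h_c' = 1. *)
have -> : (if b == a^' then
    lam * h a * \sum_(j < N | (j < a)%N) h j^' * Rop23 (Rop12 f) j^' j c else 0)
  = (if b == a^' then lam * h a * (\sum_(j < N | (j < a)%N) h j^' * f c j^' j
      + (if (c^' < a)%N then 0 else
         lam * \sum_(j < N | (j < c^')%N) h j^' * (w j c * f j^' c j))) else 0).
  case: eqP => // /eqP ba; congr (_ * _).
  under eq_bigr => j ja do rewrite (Rop2312_pair f ba ab bc ja) mulrBr mulrDr.
  rewrite sumrB big_split /= -addrA; congr (_ + _).
  have -> : \sum_(j < N | (j < a)%N)
      h j^' * (if (j < c^')%N then lam * (w j c * f j^' c j) else 0)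
    = lam * \sum_(j < N | (j < c^')%N) h j^' * (w j c * f j^' c j).
    rewrite mulr_sumr big_mkcond [RHS]big_mkcond; apply: eq_bigr => j _ /=.
    case: (ltnP j c^') => jc; last by rewrite mulr0 if_same.
    have -> : (j < a)%N by ord_lia.
    by ring.
  case: ifP => ca; last first.
    rewrite [X in _ - X]big1 ?subr0 // => j ja; case: eqP; rewrite ?mulr0 // => /eqP jc.
    by move: ca ja; ord_lia.
  rewrite [X in _ - X](bigD1 c^') //= eqxx [X in _ - (_ + X)]big1 ?addr0.
    rewrite rev_ordK; ring: (h_rev c).
  by move=> j /andP[_ /negPf ->]; rewrite mulr0.
(* The same collapse with j = a, which lies in the range j < b exactly when a < b. *)
have -> : (if c == b^' then
    lam * h b * \sum_(j < N | (j < b)%N) h j^' * Rop12 (Rop23 f) a j^' j else 0)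
  = (if c == b^' then lam * h b * (\sum_(j < N | (j < b)%N) h j^' * f j^' j a
      + (if (a < b)%N then 0 else
         lam * \sum_(j < N | (j < a)%N) h j^' * (w j a * f j^' a j))) else 0).
  case: eqP => // /eqP cb; congr (_ * _).
  under eq_bigr => j jb do rewrite (Rop1223_pair f cb ab bc jb) mulrBr mulrDr.
  rewrite sumrB big_split /= -addrA; congr (_ + _).
  have -> : \sum_(j < N | (j < b)%N)
      h j^' * (if (j < a)%N then lam * (w j a * f j^' a j) else 0)
    = lam * \sum_(j < N | (j < a)%N) h j^' * (w j a * f j^' a j).
    rewrite mulr_sumr big_mkcond [RHS]big_mkcond; apply: eq_bigr => j _ /=.
    case: (ltnP j a) => ja; last by rewrite mulr0 if_same.
    have -> : (j < b)%N by ord_lia.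
    by ring.
  case: ifP => ca; last first.
    rewrite [X in _ - X]big1 ?subr0 // => j ja; case: eqP; rewrite ?mulr0 // => /eqP jc.
    by move: ca ja; ord_lia.
  rewrite [X in _ - X](bigD1 a) //= eqxx [X in _ - (_ + X)]big1 ?addr0.
    ring: (h_rev a).
  by move=> j /andP[_ /negPf ->]; rewrite mulr0.
case: (boolP (c == b^')) => [cb|cb].
  case: (eqVneq a b) cb => [<-|nab] cb.
    rewrite (eqP cb) eqxx ltnn rev_ordK.
    case: (eqVneq a a^') => [E|E].
      by rewrite -E ltnn (w_mid W E); ring.
    by rewrite (w_diag W) // (w_opp W) //; field.
  have lab : (a < b)%N by ord_lia.
  have -> : (c == a^') = false by ord_lia.
  have -> : (b == a^') = false by ord_lia.
  have wab : w a b * w a c = 1.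
    by rewrite (eqP cb) (w_revr W) ?(w_inv W) //; ord_lia.
  by rewrite lab; ring: wab.
case: (boolP (c == a^')) => [ca|ca].
  have lab : a != b by move: cb ca; ord_lia.
  case: (boolP (b == a^')) => [ba|ba].
    have -> : b = c by apply/eqP; ord_lia.
    rewrite (eqP ca) rev_ordK ltnn.
    have E : a != a^' by ord_lia.
    have E' : a^' != a^'^' by rewrite rev_ordK eq_sym.
    by rewrite (w_opp W) // (w_diag W) //; field.
  rewrite (eqP ca).
  have -> : w b a^' = w a b by rewrite (w_revr W) //; ord_lia.
  by ring.
case: (eqVneq b a^') => [/eqP ba|_] /=; last by ring.
have lca : (c^' < a)%N by ord_lia.
have wbc : w b c * w a c = 1.
  by rewrite (eqP ba) (w_revl W) ?(w_inv W) //; ord_lia.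
by rewrite lca; ring: wbc.
Qed.

Definition depth a : nat := minn a a^'.

Lemma depth_rev a : depth a^' = depth a.
Proof. by rewrite /depth rev_ordK minnC. Qed.

Lemma depth_lt j a : (j < a)%N -> (a < a^')%N -> (depth j < depth a)%N.
Proof. by rewrite /depth !val_rev_ord; have := ltn_ord a; lia. Qed.

(* For a < a', the row (a, a') of R g expresses g(a', a) through the outer
   entries g(j', j), j < a: hence the induction on the total depth, inside which
   every triple is reached from a sorted one by transpositions. *)
Lemma zero_rows_spread (T : Type) (g : T -> 'I_N -> 'I_N -> 'I_N -> K) :
  (forall a b c, (forall x, g x a b c = 0) -> forall x, Rop12 (g x) a b c = 0) ->
  (forall a b c, (forall x, g x a b c = 0) -> forall x, Rop23 (g x) a b c = 0) ->
  (forall a b c, (a <= b)%N -> (b <= c)%N -> forall x, g x a b c = 0) ->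
  forall a b c x, g x a b c = 0.
Proof.
move=> g1 g2 g_sorted a b c.
have [m] := ubnP (depth a + depth b + depth c); elim: m => // m IHm in a b c *.
rewrite ltnS => lem.
have w_neq0 x y : x != y -> x != y^' -> w x y != 0.
  move=> xy xyr; have := w_inv W xy xyr.
  by apply: contra_eq_neq => ->; rewrite mul0r eq_sym oner_eq0.
(* Row (x, y, z) of R_12 g is w(x, y) g(y, x, z) minus cup terms; these have smaller total depth and
   vanish by induction, and the weight is invertible. *)
have swap1 x y z : (depth x + depth y + depth z <= m)%N -> (x < y)%N ->
    (forall u, g u x y z = 0) -> forall u, g u y x z = 0.
  move=> le_m lxy gxy u; have := g1 _ _ _ gxy u; rewrite /Rop12 Rop_le ?(ltnW lxy) //.
  case: eqP => [/eqP yx|/eqP yx].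
    rewrite big1 => [|j jx].
      rewrite mulr0 subr0 (eqP yx) (w_opp W); last by ord_lia.
      by move/eqP; rewrite mulf_eq0 invr_eq0 (negPf q_neq0) => /eqP.
    rewrite IHm ?mulr0 //; move: lxy le_m; rewrite (eqP yx) !depth_rev => lxy.
    by move: (depth_lt jx lxy); clear; lia.
  rewrite subr0 => /eqP; rewrite mulf_eq0 (negPf (w_neq0 _ _ _ _)) //.
  - by move/eqP.
  - by ord_lia.
  - by ord_lia.
have swap2 x y z : (depth x + depth y + depth z <= m)%N -> (y < z)%N ->
    (forall u, g u x y z = 0) -> forall u, g u x z y = 0.
  move=> le_m lxy gxy u; have := g2 _ _ _ gxy u; rewrite /Rop23 Rop_le ?(ltnW lxy) //.
  case: eqP => [/eqP yx|/eqP yx].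
    rewrite big1 => [|j jx].
      rewrite mulr0 subr0 (eqP yx) (w_opp W); last by ord_lia.
      by move/eqP; rewrite mulf_eq0 invr_eq0 (negPf q_neq0) => /eqP.
    rewrite IHm ?mulr0 //; move: lxy le_m; rewrite (eqP yx) !depth_rev => lxy.
    by move: (depth_lt jx lxy); clear; lia.
  rewrite subr0 => /eqP; rewrite mulf_eq0 (negPf (w_neq0 _ _ _ _)) //.
  - by move/eqP.
  - by ord_lia.
  - by ord_lia.
(* At most three adjacent transpositions lead from the sorted triple to (a, b, c); they preserve the
   total depth. *)
case: (leqP a b) => ab; case: (leqP b c) => bc; case: (leqP a c) => ac.
- exact: g_sorted.
- exact: g_sorted.
- by apply: (swap2 _ _ _); [lia | | apply: g_sorted; lia].
- by apply: (swap2 _ _ _); [lia | |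
    apply: (swap1 _ _ _); [lia | | apply: g_sorted; lia]]; lia.
- by apply: (swap1 _ _ _); [lia | | apply: g_sorted; lia].
- by apply: (swap1 _ _ _); [lia | |
    apply: (swap2 _ _ _); [lia | | apply: g_sorted; lia]]; lia.
- by move: bc (leq_trans ab ac); rewrite ltnNge => /negP bc /ltnW.
- by apply: (swap1 _ _ _); [lia | | apply: (swap2 _ _ _); [lia | |
    apply: (swap1 _ _ _); [lia | | apply: g_sorted; lia]]]; lia.
Qed.

End Braid.

(** * Two-site and three-site matrices *)

Lemma mulmx_cV_inj (K : pzRingType) m n (A B : 'M[K]_(m, n)) :
  (forall x : 'cV[K]_n, A *m x = B *m x) -> A = B.
Proof.
move=> AB; apply/matrixP => i j.
by have /matrixP/(_ i 0) := AB (delta_mx j 0); rewrite -!colE !mxE.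
Qed.

Lemma big_mxtens (R : nmodType) m n (F : 'I_(m * n) -> R) :
  \sum_s F s = \sum_(i < m) \sum_(j < n) F (mxtens_index (i, j)).
Proof.
rewrite pair_bigA /= (reindex (@mxtens_index m n)) /=.
  by apply: eq_bigr => -[i j].
by exists (@mxtens_unindex m n) => s _; rewrite (mxtens_indexK, mxtens_unindexK).
Qed.

(** * Formal consequences of the crossing relations *)

Section BraidAlgebra.
Variables (K : fieldType) (m k : nat) (lam pinv : K).
Variables (R1 R2 : 'M[K]_m) (phi1 phi2 : 'M[K]_(k, m)) (psi1 psi2 : 'M[K]_(m, k)).

Definition bar (R : 'M[K]_m) (psi : 'M[K]_(m, k)) (phi : 'M[K]_(k, m)) :=
  R - lam *: 1%:M + lam *: (psi *m phi).

Local Notation V1 := (bar R1 psi1 phi1).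
Local Notation V2 := (bar R2 psi2 phi2).

(** The zigzags give phi2 V1 = phi2 R1 - lam phi2 + lam phi1 and phi1 V2 = phi1 R2 - lam phi1 + lam
    phi2, so the two crossings are equivalent. *)
Lemma cross_opp : phi1 *m R2 = phi2 *m V1 -> phi2 *m psi1 = 1%:M ->
  phi1 *m psi2 = 1%:M -> phi2 *m R1 = phi1 *m V2.
Proof.
move=> cross z1 z2; rewrite /bar !(mulmxDr, mulmxN) -!scalemxAr !mulmx1.
rewrite !mulmxA z2 mul1mx cross /bar !(mulmxDr, mulmxN) -!scalemxAr !mulmx1.
by rewrite !mulmxA z1 mul1mx addrK subrK.
Qed.

Hypothesis RV1 : R1 *m V1 = 1%:M.
Hypothesis RV2 : R2 *m V2 = 1%:M.
Hypothesis phiR1 : phi1 *m R1 = pinv *: phi1.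
Hypothesis phiR2 : phi2 *m R2 = pinv *: phi2.
Hypothesis cross1 : phi1 *m R2 = phi2 *m V1.
Hypothesis cross2 : R1 *m psi2 = V2 *m psi1.

(** Since phi1 D = 0, V1 D = R1 D - lam D. On the other hand V1 D = R2 R1 - V1 R2 R1 R2, while D R2
    is expanded by the quadratic relation of R2. The cup-cap corrections agree because phi1 R2 R1 =
    phi2 and R2 R1 psi2 = psi1, whence V1 D = - D R2. *)
Lemma defect_intertwine (D := R1 *m R2 *m R1 - R2 *m R1 *m R2) :
  R1 *m D = lam *: D - D *m R2.
Proof.
have VR1 := mulmx1C RV1.
have phi1RR : phi1 *m R2 *m R1 = phi2 by rewrite cross1 -mulmxA VR1 mulmx1.
have RRpsi2 : R2 *m R1 *m psi2 = psi1 by rewrite -mulmxA cross2 mulmxA RV2 mul1mx.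
have phi1D : phi1 *m D = 0.
  by rewrite mulmxBr !mulmxA phiR1 phi1RR -!scalemxAl phi1RR phiR2 subrr.
have R2E : R2 = V2 + lam *: 1%:M - lam *: (psi2 *m phi2).
  by rewrite /bar addrAC addrK subrK.
have sqR2 : R2 *m R2 = 1%:M + lam *: R2 - (lam * pinv) *: (psi2 *m phi2).
  rewrite {1}R2E mulmxBl mulmxDl (mulmx1C RV2) -!scalemxAl mul1mx -mulmxA phiR2.
  by rewrite -scalemxAr scalerA.
have DR2 : D *m R2 = R1 *m R2 *m R1 *m R2 - R2 *m R1 - lam *: (R2 *m R1 *m R2)
    + (lam * pinv) *: (psi1 *m phi2).
  rewrite mulmxBl -[R2 *m R1 *m R2 *m R2]mulmxA sqR2 mulmxBr mulmxDr mulmx1.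
  by rewrite -!scalemxAr [_ *m (psi2 *m _)]mulmxA RRpsi2 !opprD opprK !addrA.
have V1RRR : V1 *m R2 *m R1 *m R2 = R1 *m R2 *m R1 *m R2
    - lam *: (R2 *m R1 *m R2) + (lam * pinv) *: (psi1 *m phi2).
  rewrite /bar !mulmxDl !mulNmx -!scalemxAl mul1mx -[psi1 *m phi1 *m R2]mulmxA.
  rewrite -[psi1 *m _ *m R1]mulmxA phi1RR -[psi1 *m _ *m R2]mulmxA phiR2.
  by rewrite -scalemxAr scalerA.
have V1D : V1 *m D = R1 *m D - lam *: D.
  rewrite /bar !mulmxDl mulNmx -!scalemxAl mul1mx -mulmxA phi1D mulmx0.
  by rewrite scaler0 addr0.
have : V1 *m D = - (D *m R2).
  rewrite mulmxBr !mulmxA VR1 mul1mx V1RRR DR2 !opprD !opprK.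
  by rewrite !addrA [R2 *m R1 - _]addrC.
by rewrite V1D => /(canRL (subrK _)) ->; rewrite addrC.
Qed.
End BraidAlgebra.

(** * Coordinates on double and triple tensor powers *)

Section ThreeSites.
Variables (K : fieldType) (N : nat).
Implicit Types (a b c i j k : 'I_N).
Local Notation "i ^'" := (rev_ord i).
Local Notation "i ^'" := (rev_ord i) : nat_scope.
Local Notation T3 := (N * N * N)%N.

Definition idx3 a b c : 'I_T3 := mxtens_index (mxtens_index (a, b), c).
Definition coord3 (x : 'cV[K]_T3) a b c := x (idx3 a b c) 0.
Definition coord2 (x : 'cV[K]_(N * N)) a b := x (mxtens_index (a, b)) 0.

Lemma coord3P x y : (forall a b c, coord3 x a b c = coord3 y a b c) -> x = y.
Proof.
move=> xy; apply/colP => s; case: (mxtens_indexP s) => {}s c.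
by case: (mxtens_indexP s) => a b; exact: xy.
Qed.

Lemma coord2P x y : (forall a b, coord2 x a b = coord2 y a b) -> x = y.
Proof. by move=> xy; apply/colP => s; case: (mxtens_indexP s) => a b; exact: xy. Qed.

Lemma big_idx3 (F : 'I_T3 -> K) :
  \sum_s F s = \sum_a \sum_b \sum_c F (idx3 a b c).
Proof. by rewrite big_mxtens big_mxtens. Qed.

Definition site1 (X : 'M[K]_(N * N)) : 'M[K]_T3 := X *t 1%:M.
Definition site2 (X : 'M[K]_(N * N)) : 'M[K]_T3 :=
  castmx (mulnA N N N, mulnA N N N) (1%:M *t X).

Definition entry (X : 'M[K]_(N * N)) a b i j :=
  X (mxtens_index (a, b)) (mxtens_index (i, j)).

Definition action (X : 'M[K]_(N * N)) (f : 'I_N -> 'I_N -> K) a b :=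
  \sum_i \sum_j entry X a b i j * f i j.

Lemma coord2_mul X x a b : coord2 (X *m x) a b = action X (coord2 x) a b.
Proof. by rewrite /coord2 mxE big_mxtens. Qed.

Lemma coord3_site1 X x a b c :
  coord3 (site1 X *m x) a b c = action X (fun i j => coord3 x i j c) a b.
Proof.
rewrite /coord3 mxE big_idx3; apply: eq_bigr => i _; apply: eq_bigr => j _.
rewrite (bigD1 c) //= big1 ?addr0 => [|k ck]; rewrite tensmxE !mxE.
  by rewrite eqxx mulr1.
by rewrite eq_sym (negPf ck) mulr0 mul0r.
Qed.

Lemma idx3A a b c :
  cast_ord (esym (mulnA N N N)) (idx3 a b c) = mxtens_index (a, mxtens_index (b, c)).
Proof. by apply: val_inj => /=; rewrite mulnDl mulnA addnA. Qed.

Lemma coord3_site2 X x a b c :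
  coord3 (site2 X *m x) a b c = action X (coord3 x a) b c.
Proof.
rewrite /coord3 mxE big_idx3 (bigD1 a) //= [X in _ + X]big1 ?addr0 => [|i ai].
  apply: eq_bigr => i _; apply: eq_bigr => j _.
  by rewrite castmxE !idx3A tensmxE mxE eqxx mul1r.
rewrite big1 // => j _; rewrite big1 // => k _.
by rewrite castmxE !idx3A tensmxE mxE eq_sym (negPf ai) !mul0r.
Qed.

Lemma tr_site1 X : (site1 X)^T = site1 X^T.
Proof. by rewrite /site1 trmx_tens trmx1. Qed.

Lemma tr_site2 X : (site2 X)^T = site2 X^T.
Proof. by rewrite /site2 trmx_cast trmx_tens trmx1. Qed.

End ThreeSites.

Section TensorLinear.
Variable K : comPzRingType.

Lemma tensmx11 m n : (1%:M *t 1%:M : 'M[K]_(m * n)) = 1%:M.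
Proof.
apply/matrixP => s t; case: (mxtens_indexP s) => a b; case: (mxtens_indexP t) => i j.
rewrite tensmxE !mxE (inj_eq (can_inj (@mxtens_indexK _ _))) xpair_eqE.
by rewrite -natrM mulnb.
Qed.

Lemma tensmxDl m n p r (A B : 'M[K]_(m, n)) (C : 'M[K]_(p, r)) :
  (A + B) *t C = A *t C + B *t C.
Proof. by apply/matrixP => i j; rewrite !mxE mulrDl. Qed.

Lemma tensmxDr m n p r (A : 'M[K]_(m, n)) (B C : 'M[K]_(p, r)) :
  A *t (B + C) = A *t B + A *t C.
Proof. by apply/matrixP => i j; rewrite !mxE mulrDr. Qed.

Lemma tensmxZl m n p r a (A : 'M[K]_(m, n)) (C : 'M[K]_(p, r)) :
  (a *: A) *t C = a *: (A *t C).
Proof. by apply/matrixP => i j; rewrite !mxE mulrA. Qed.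

Lemma tensmxZr m n p r a (A : 'M[K]_(m, n)) (C : 'M[K]_(p, r)) :
  A *t (a *: C) = a *: (A *t C).
Proof. by apply/matrixP => i j; rewrite !mxE mulrCA. Qed.

Lemma castmxD m n m' n' (e : (m = m') * (n = n')) (A B : 'M[K]_(m, n)) :
  castmx e (A + B) = castmx e A + castmx e B.
Proof. by apply/matrixP => i j; rewrite !(castmxE, mxE). Qed.

Lemma castmxZ m n m' n' (e : (m = m') * (n = n')) a (A : 'M[K]_(m, n)) :
  castmx e (a *: A) = a *: castmx e A.
Proof. by apply/matrixP => i j; rewrite !(castmxE, mxE). Qed.

Lemma castmx1 m n (e : m = n) : castmx (e, e) (1%:M : 'M[K]_m) = 1%:M.
Proof. by case: n / e; rewrite castmx_id. Qed.

Lemma castmxM m n (e : m = n) (A B : 'M[K]_m) :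
  castmx (e, e) (A *m B) = castmx (e, e) A *m castmx (e, e) B.
Proof. by case: n / e; rewrite !castmx_id. Qed.

End TensorLinear.

Section Sites.
Variables (K : fieldType) (N : nat).
Implicit Types X Y : 'M[K]_(N * N).

Lemma site1M X Y : site1 (X *m Y) = site1 X *m site1 Y.
Proof. by rewrite /site1 tensmx_mul mulmx1. Qed.
Lemma site2M X Y : site2 (X *m Y) = site2 X *m site2 Y.
Proof. by rewrite /site2 -castmxM tensmx_mul mulmx1. Qed.
Lemma site1D X Y : site1 (X + Y) = site1 X + site1 Y.
Proof. exact: tensmxDl. Qed.
Lemma site2D X Y : site2 (X + Y) = site2 X + site2 Y.
Proof. by rewrite /site2 tensmxDr castmxD. Qed.
Lemma site1Z a X : site1 (a *: X) = a *: site1 X.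
Proof. exact: tensmxZl. Qed.
Lemma site2Z a X : site2 (a *: X) = a *: site2 X.
Proof. by rewrite /site2 tensmxZr castmxZ. Qed.
Lemma site1_1 : site1 1%:M = 1%:M :> 'M[K]_(N * N * N).
Proof. exact: tensmx11. Qed.
Lemma site2_1 : site2 1%:M = 1%:M :> 'M[K]_(N * N * N).
Proof. by rewrite /site2 tensmx11 castmx1. Qed.

End Sites.

(** * The matrices of R, K and the caps *)

Section BMWMatrices.
Variables (K : fieldType) (N : nat) (q : K) (h : 'I_N -> K).
Implicit Types (a b c i j k : 'I_N) (X Y : 'M[K]_(N * N)).
Local Notation "i ^'" := (rev_ord i).
Local Notation "i ^'" := (rev_ord i) : nat_scope.
Local Notation lam := (q - q^-1).
Local Notation T3 := (N * N * N)%N.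

(** Row (a, b), column (i, j). The factor h_i of the last term is the h_j' of [Rop], as i = j'
    there. *)
Definition brR_entry (w : 'I_N -> 'I_N -> K) a b i j : K :=
  w a b *+ ((i == b) && (j == a)) + lam *+ [&& i == a, j == b & (b < a)%N]
  - (lam * h a * h i) *+ [&& b == a^', i == j^' & (j < a)%N].

Definition brK_entry a b i j : K := (h a * h i) *+ ((b == a^') && (i == j^')).

Definition mx_of_entry (E : 'I_N -> 'I_N -> 'I_N -> 'I_N -> K) : 'M[K]_(N * N) :=
  \matrix_(s, t) E (mxtens_unindex s).1 (mxtens_unindex s).2
                   (mxtens_unindex t).1 (mxtens_unindex t).2.

Definition brR w := mx_of_entry (brR_entry w).
Definition brK := mx_of_entry brK_entry.
Definition brV w := brR w - lam *: 1%:M + lam *: brK.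

(** The maps phi (x) id and id (x) phi from the triple tensor power to V; their transposes are the
    corresponding cups. *)
Definition phi1 : 'M[K]_(N, T3) := \matrix_(c, s)
  let: (ij, k) := mxtens_unindex s in let: (i, j) := mxtens_unindex ij in
  h i *+ ((j == i^') && (k == c)).
Definition phi2 : 'M[K]_(N, T3) := \matrix_(c, s)
  let: (ij, k) := mxtens_unindex s in let: (i, j) := mxtens_unindex ij in
  h j *+ ((k == j^') && (i == c)).

Lemma entryE E a b i j : entry (mx_of_entry E) a b i j = E a b i j.
Proof. by rewrite /entry mxE !mxtens_indexK. Qed.

Lemma phi1E c i j k : phi1 c (idx3 i j k) = h i *+ ((j == i^') && (k == c)).
Proof. by rewrite mxE !mxtens_indexK. Qed.

Lemma phi2E c i j k : phi2 c (idx3 i j k) = h j *+ ((k == j^') && (i == c)).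
Proof. by rewrite mxE !mxtens_indexK. Qed.

Lemma sum_mulrb (T : finType) (F : T -> K) t (P : bool) :
  \sum_u F u *+ ((u == t) && P) = F t *+ P.
Proof.
rewrite (bigD1 t) //= eqxx big1 ?addr0 // => u /negPf ->.
by rewrite mulr0n.
Qed.

Lemma phi1_mul x c :
  (phi1 *m x) c 0 = cap h (fun i j => coord3 x i j c).
Proof.
rewrite mxE big_idx3 /cap; apply: eq_bigr => i _.
under eq_bigr => j _ do under eq_bigr => k _ do
  rewrite phi1E mulrnAl -[_ && _]andbC.
under eq_bigr => j _ do rewrite sum_mulrb -[_ == _]andbT.
by rewrite sum_mulrb.
Qed.

Lemma phi2_mul x c :
  (phi2 *m x) c 0 = cap h (fun i j => coord3 x c i j).
Proof.
rewrite mxE big_idx3 /cap exchange_big; apply: eq_bigr => j _ /=.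
under eq_bigr => i _ do under eq_bigr => k _ do rewrite phi2E mulrnAl.
under eq_bigr => i _ do rewrite sum_mulrb -[_ == _]andbT.
by rewrite sum_mulrb.
Qed.

Lemma psi1_mul y a b c :
  coord3 (phi1^T *m y) a b c = (h a * y c 0) *+ (b == a^').
Proof.
rewrite /coord3 mxE (bigD1 c) //= big1 ?addr0 => [|d dc]; rewrite mxE phi1E.
  by rewrite eqxx andbT mulrnAl.
by rewrite [c == d]eq_sym (negPf dc) andbF mul0r.
Qed.

Lemma psi2_mul y a b c :
  coord3 (phi2^T *m y) a b c = (h b * y a 0) *+ (c == b^').
Proof.
rewrite /coord3 mxE (bigD1 a) //= big1 ?addr0 => [|d dc]; rewrite mxE phi2E.
  by rewrite eqxx andbT mulrnAl.
by rewrite [a == d]eq_sym (negPf dc) andbF mul0r.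
Qed.

Lemma action_brK f a b : action brK f a b = (h a * cap h f) *+ (b == a^').
Proof.
rewrite /action /cap mulr_sumr -sumrMnl; apply: eq_bigr => i _.
under eq_bigr => j _ do rewrite entryE /brK_entry mulrnAl.
have E j : (b == a^') && (i == j^') = (j == i^') && (b == a^').
  by rewrite andbC; congr andb; apply/eqP/eqP => ->; rewrite rev_ordK.
by under eq_bigr => j _ do rewrite E; rewrite sum_mulrb mulrA.
Qed.

Lemma action_brR w f a b : action (brR w) f a b = Rop q h w f a b.
Proof.
rewrite /action.
under eq_bigr => i _ do under eq_bigr => j _ do
  rewrite entryE /brR_entry mulrBl mulrDl !mulrnAl.
under eq_bigr => i _ do rewrite sumrB big_split /=.
rewrite sumrB big_split /= /Rop; congr (_ + _ - _).
- under eq_bigr => i _ do under eq_bigr => j _ do rewrite andbC.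
  under eq_bigr => i _ do rewrite sum_mulrb -[_ == _]andbT.
  by rewrite sum_mulrb.
- under eq_bigr => i _ do under eq_bigr => j _ do rewrite andbCA.
  under eq_bigr => i _ do rewrite sum_mulrb.
  by rewrite sum_mulrb; case: ifP.
rewrite exchange_big /=.
under eq_bigr => j _ do under eq_bigr => i _ do rewrite andbCA.
under eq_bigr => j _ do rewrite sum_mulrb.
case: eqP => _ /=; last by rewrite big1.
rewrite mulr_sumr [RHS]big_mkcond; apply: eq_bigr => j _ /=.
by case: ifP => _ //; rewrite mulr1n !mulrA.
Qed.

Lemma actionD X Y f a b :
  action (X + Y) f a b = action X f a b + action Y f a b.
Proof.
rewrite /action -big_split; apply: eq_bigr => i _; rewrite -big_split.
by apply: eq_bigr => j _; rewrite /entry mxE mulrDl.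
Qed.

Lemma actionZ t X f a b : action (t *: X) f a b = t * action X f a b.
Proof.
rewrite /action mulr_sumr; apply: eq_bigr => i _; rewrite mulr_sumr.
by apply: eq_bigr => j _; rewrite /entry mxE mulrA.
Qed.

Lemma action1 f a b : action (1%:M : 'M[K]_(N * N)) f a b = f a b.
Proof.
rewrite /action.
under eq_bigr => i _ do under eq_bigr => j _ do
  rewrite /entry mxE (inj_eq (can_inj (@mxtens_indexK _ _))) eq_sym xpair_eqE
    mulr_natl andbC.
under eq_bigr => i _ do rewrite sum_mulrb -[_ == _]andbT.
by rewrite sum_mulrb.
Qed.

Lemma action_brV w f a b : action (brV w) f a b = Rvop q h w f a b.
Proof.
rewrite !actionD -scaleNr !actionZ action_brR action1 action_brK /Rvop.
by rewrite mulNr; case: eqP => _; rewrite ?mulr0.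
Qed.

End BMWMatrices.

(** * The BWM relations on two and three factors *)

Section BMWRelations.
Variables (K : fieldType) (N : nat) (q pinv : K) (h : 'I_N -> K).
Implicit Types (a b c i j k : 'I_N) (X Y : 'M[K]_(N * N)).
Local Notation "i ^'" := (rev_ord i).
Local Notation "i ^'" := (rev_ord i) : nat_scope.
Local Notation lam := (q - q^-1).

Hypothesis q_neq0 : q != 0.
Hypothesis h_rev : forall a, h a * h a^' = 1.

Local Notation phi1 := (phi1 h).
Local Notation phi2 := (phi2 h).
Local Notation brR := (brR q h).
Local Notation brV := (brV q h).
Local Notation brK := (brK h).

Lemma coord3D (x y : 'cV[K]_(N * N * N)) a b c :
  coord3 (x + y) a b c = coord3 x a b c + coord3 y a b c.
Proof. by rewrite /coord3 mxE. Qed.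

Lemma coord3Z t (x : 'cV[K]_(N * N * N)) a b c :
  coord3 (t *: x) a b c = t * coord3 x a b c.
Proof. by rewrite /coord3 mxE. Qed.

Lemma coord2Z t (x : 'cV[K]_(N * N)) a b :
  coord2 (t *: x) a b = t * coord2 x a b.
Proof. by rewrite /coord2 mxE. Qed.

(** The diagonal and cup parts are symmetric: for b = a' and i = j', the conditions j < a and b < i
    are equivalent. *)
Lemma tr_brR w : (brR w)^T = brR (fun a b => w b a).
Proof.
apply/matrixP => s t; rewrite !mxE /brR_entry.
move: (mxtens_unindex s) (mxtens_unindex t) => [a b] [i j] /=.
congr (_ + _ - _).
- rewrite [i == b]eq_sym [j == a]eq_sym andbC.
  by case: (eqVneq b i) => [->|_] //=; case: (eqVneq a j) => [->|_].
- rewrite [a == i]eq_sym [b == j]eq_sym.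
  case: (eqVneq i a) => //= ->; case: (eqVneq j b) => //= ->; by [].
rewrite mulrAC.
suff -> : [&& j == i^', a == b^' & (b < i)%N] = [&& b == a^', i == j^' & (j < a)%N].
  by [].
by apply/idP/idP; ord_lia.
Qed.

Lemma site1_brK : site1 brK = phi1^T *m phi1.
Proof.
apply: mulmx_cV_inj => x; apply: coord3P => a b c.
by rewrite coord3_site1 action_brK -mulmxA psi1_mul phi1_mul.
Qed.

Lemma site2_brK : site2 brK = phi2^T *m phi2.
Proof.
apply: mulmx_cV_inj => x; apply: coord3P => a b c.
by rewrite coord3_site2 action_brK -mulmxA psi2_mul phi2_mul.
Qed.

(** Straightening the strand costs the factor h_c' h_c = 1. *)
Lemma zigzag21 : phi2 *m phi1^T = 1%:M.
Proof.
apply: mulmx_cV_inj => y; apply/colP => c; rewrite -mulmxA phi2_mul mul1mx /cap.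
under eq_bigr => i _ do rewrite psi1_mul mulrnAr -[_ == _]andbT.
by rewrite sum_mulrb rev_ordK mulrA [h c^' * _]mulrC h_rev mul1r.
Qed.

Lemma zigzag12 : phi1 *m phi2^T = 1%:M.
Proof.
by rewrite -[RHS]trmx1 -zigzag21 trmx_mul trmxK.
Qed.

Lemma site1_brV w : site1 (brV w) = bar lam (site1 (brR w)) phi1^T phi1.
Proof. by rewrite /brV -scaleNr !site1D !site1Z site1_1 site1_brK scaleNr. Qed.

Lemma site2_brV w : site2 (brV w) = bar lam (site2 (brR w)) phi2^T phi2.
Proof. by rewrite /brV -scaleNr !site2D !site2Z site2_1 site2_brK scaleNr. Qed.

Lemma action_ext X f g a b :
  (forall i j, f i j = g i j) -> action X f a b = action X g a b.
Proof.
by move=> fg; apply: eq_bigr => i _; apply: eq_bigr => j _; rewrite fg.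
Qed.

Lemma cap_ext f g : (forall i j, f i j = g i j) -> cap h f = cap h g.
Proof. by move=> fg; apply: eq_bigr => i _; rewrite fg. Qed.

Lemma cross1 w : weight_axioms q w ->
  phi1 *m site2 (brR w) = phi2 *m site1 (brV w).
Proof.
move=> W; apply: mulmx_cV_inj => x; apply/colP => c.
rewrite -!mulmxA phi1_mul phi2_mul /cap.
under eq_bigr => i _ do rewrite coord3_site2 action_brR.
under [RHS]eq_bigr => i _ do rewrite coord3_site1 action_brV.
exact: cap_cross.
Qed.

Lemma cross2 w : weight_axioms q w ->
  phi2 *m site1 (brR w) = phi1 *m site2 (brV w).
Proof.
move=> W; rewrite site2_brV; apply: cross_opp zigzag21 zigzag12.
by rewrite -site1_brV; apply: cross1.
Qed.

Variable w : 'I_N -> 'I_N -> K.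
Hypothesis W : weight_axioms q w.
Hypothesis h_sum : forall j,
  lam * (\sum_(a < N | (j < a)%N) h a ^+ 2)
  = w j j^' * h j ^+ 2 + (if (j < j^')%N then lam else 0) - pinv.

Let wT a b := w b a.
Let WT : weight_axioms q wT := weight_axiomsT W.

Lemma tr_brV : (brV wT)^T = brV w.
Proof.
rewrite /brV -!scaleNr !linearD !linearZ /= trmx1 tr_brR; congr (_ + _ *: _).
apply/matrixP => s t; rewrite !mxE /brK_entry.
move: (mxtens_unindex s) (mxtens_unindex t) => [a b] [i j] /=.
rewrite mulrC; congr (_ *+ nat_of_bool _).
by apply/idP/idP; ord_lia.
Qed.

(** The transpose of the cap crossing for the weights [wT]. *)
Lemma cross1T : site2 (brR w) *m phi1^T = site1 (brV w) *m phi2^T.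
Proof.
apply: trmx_inj; rewrite !trmx_mul !trmxK tr_site1 tr_site2 -tr_brV trmxK tr_brR.
exact: cross1.
Qed.

Lemma cross2T : site1 (brR w) *m phi2^T = site2 (brV w) *m phi1^T.
Proof.
apply: trmx_inj; rewrite !trmx_mul !trmxK tr_site1 tr_site2 -tr_brV trmxK tr_brR.
exact: cross2.
Qed.

Lemma brR_brV : brR w *m brV w = 1%:M.
Proof.
apply: mulmx_cV_inj => x; apply: coord2P => a b; rewrite -mulmxA mul1mx.
rewrite coord2_mul (action_ext _ _ _ (fun i j => coord2_mul _ _ i j)).
rewrite (action_ext _ _ _ (fun i j => action_brV _ _ _ _ i j)) action_brR.
exact: (RopK q_neq0 h_rev W h_sum).
Qed.

Lemma brV_brR : brV w *m brR w = 1%:M.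
Proof. exact: mulmx1C brR_brV. Qed.

Lemma brK_brR : brK *m brR w = pinv *: brK.
Proof.
apply: mulmx_cV_inj => x; apply: coord2P => a b; rewrite -mulmxA -scalemxAl.
rewrite coord2Z !coord2_mul !action_brK.
rewrite (cap_ext (fun i j => coord2_mul _ _ i j)).
rewrite (cap_ext (fun i j => action_brR _ _ _ _ i j)).
by rewrite (cap_Rop h_rev h_sum) mulrnAr mulrCA.
Qed.

Lemma phi1_site1 : phi1 *m site1 (brR w) = pinv *: phi1.
Proof.
apply: mulmx_cV_inj => x; apply/colP => c.
rewrite -mulmxA -scalemxAl [RHS]mxE !phi1_mul -(cap_Rop h_rev h_sum).
by apply: cap_ext => i j; rewrite coord3_site1 action_brR.
Qed.

Lemma phi2_site2 : phi2 *m site2 (brR w) = pinv *: phi2.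
Proof.
apply: mulmx_cV_inj => x; apply/colP => c.
rewrite -mulmxA -scalemxAl [RHS]mxE !phi2_mul -(cap_Rop h_rev h_sum).
by apply: cap_ext => i j; rewrite coord3_site2 action_brR.
Qed.

Let R1 := site1 (brR w).
Let R2 := site2 (brR w).

(** The intertwining relations let zero rows of D spread by [zero_rows_spread], starting from the
    sorted rows given by [braid_sorted]. *)
Lemma braid_eq : R1 *m R2 *m R1 = R2 *m R1 *m R2.
Proof.
pose D := R1 *m R2 *m R1 - R2 *m R1 *m R2.
have RV1 : R1 *m bar lam R1 phi1^T phi1 = 1%:M.
  by rewrite -site1_brV -site1M brR_brV site1_1.
have RV2 : R2 *m bar lam R2 phi2^T phi2 = 1%:M.
  by rewrite -site2_brV -site2M brR_brV site2_1.
have D1 : R1 *m D = lam *: D - D *m R2.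
  apply: (defect_intertwine RV1 RV2 phi1_site1 phi2_site2).
    by rewrite -site1_brV; apply: cross1.
  by rewrite -site2_brV; apply: cross2T.
have D2 : R2 *m D = lam *: D - D *m R1.
  (* Exchanging the roles of the two sites changes the sign of D. *)
  have: R2 *m (- D) = lam *: (- D) - (- D) *m R1.
    rewrite opprB; apply: (defect_intertwine RV2 RV1 phi2_site2 phi1_site1).
      by rewrite -site2_brV; apply: cross2.
    by rewrite -site1_brV; apply: cross1T.
  by rewrite mulmxN mulNmx scalerN -opprD => /oppr_inj.
suff D0 : forall a b c x, coord3 (D *m x) a b c = 0.
  apply/eqP; rewrite -subr_eq0; apply/eqP; apply: mulmx_cV_inj => x.
  by apply: coord3P => a b c; rewrite mul0mx D0 /coord3 mxE.
pose g x a b c := coord3 (D *m x) a b c.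
(* The parameter runs over all column vectors, so a zero row of D also annihilates R1 x and R2 x,
   which disposes of the terms D R1 and D R2. *)
apply: (zero_rows_spread (h := h) q_neq0 W (g := g)) => [a b c|a b c|a b c ab bc x].
- rewrite /g => g0 x; rewrite /Rop12 -action_brR -coord3_site1 mulmxA D1.
  by rewrite mulmxBl -scalemxAl -mulmxA -scaleN1r coord3D !coord3Z !g0 !mulr0 addr0.
- rewrite /g => g0 x; rewrite /Rop23 -action_brR -coord3_site2 mulmxA D2.
  by rewrite mulmxBl -scalemxAl -mulmxA -scaleN1r coord3D !coord3Z !g0 !mulr0 addr0.
have E1 y f : (forall i j k, coord3 y i j k = f i j k) ->
    forall i j k, coord3 (R1 *m y) i j k = Rop12 q h w f i j k.
  by move=> yf i j k; rewrite coord3_site1 /Rop12 -action_brR; apply: action_ext.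
have E2 y f : (forall i j k, coord3 y i j k = f i j k) ->
    forall i j k, coord3 (R2 *m y) i j k = Rop23 q h w f i j k.
  by move=> yf i j k; rewrite coord3_site2 /Rop23 -action_brR; apply: action_ext.
rewrite /g mulmxBl -scaleN1r coord3D coord3Z mulN1r -!mulmxA.
rewrite (E1 _ _ (E2 _ _ (E1 _ _ (fun _ _ _ => erefl)))).
rewrite (E2 _ _ (E1 _ _ (E2 _ _ (fun _ _ _ => erefl)))).
by rewrite (braid_sorted q_neq0 h_rev W) ?subrr.
Qed.

(** With K_23 = psi2 phi2, the inner factor is phi2 R1 psi2 = phi2 V2 psi1 = p phi2 psi1 = p. *)
Lemma cap_site1_cup p : p * pinv = 1 ->
  site2 brK *m site1 (brR w) *m site2 brK = p *: site2 brK.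
Proof.
move=> pp; have phi2V : phi2 *m site2 (brV w) = p *: phi2.
  rewrite -[X in _ = p *: X]mulmx1 -site2_1 -brR_brV site2M mulmxA phi2_site2.
  by rewrite -scalemxAl scalerA pp scale1r.
have E : phi2 *m site1 (brR w) *m phi2^T = p *: 1%:M.
  by rewrite -mulmxA cross2T mulmxA phi2V -scalemxAl zigzag21.
rewrite site2_brK !mulmxA -(mulmxA phi2^T) -(mulmxA phi2^T) E.
by rewrite -scalemxAr mulmx1 -scalemxAl.
Qed.

(** The inner factor is phi2 V1 psi2 = phi2 R2 psi1 = pinv phi2 psi1 = pinv. *)
Lemma cap_site1V_cup :
  site2 brK *m site1 (brV w) *m site2 brK = pinv *: site2 brK.
Proof.
have E : phi2 *m site1 (brV w) *m phi2^T = pinv *: 1%:M.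
  by rewrite -mulmxA -cross1T mulmxA phi2_site2 -scalemxAl zigzag21.
rewrite site2_brK !mulmxA -(mulmxA phi2^T) -(mulmxA phi2^T) E.
by rewrite -scalemxAr mulmx1 -scalemxAl.
Qed.

End BMWRelations.

(** * The R-matrix of type B *)

Lemma sum_pick (R : nmodType) (T : finType) (F : T -> R) t :
  (forall x, x != t -> F x = 0) -> \sum_x F x = F t.
Proof. by move=> F0; rewrite (bigD1 t) //= big1 ?addr0. Qed.

Section RmatEntries.
Variables (n : nat) (K : fieldType) (r s sr ss : K).
Local Notation N := (2 * n).+1.
Implicit Types (a b c i j k x y : 'I_N).
Local Notation "i ^'" := (rev_ord i).
Local Notation "i ^'" := (rev_ord i) : nat_scope.
Local Notation E := (@delta_mx K N N).
Local Notation m := (mid n).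
Local Notation q := (r^-1 * s).

Lemma entry_delta x y x' y' a b i j :
  entry (E x y *t E x' y') a b i j
  = ([&& a == x, i == y, b == x' & j == y'])%:R.
Proof. by rewrite /entry tensmxE !mxE -natrM mulnb -!andbA. Qed.

Lemma entryD X Y a b i j :
  entry (X + Y : 'M[K]_(N * N)) a b i j = entry X a b i j + entry Y a b i j.
Proof. by rewrite /entry mxE. Qed.

Lemma entryZ t X a b i j :
  entry (t *: X : 'M[K]_(N * N)) a b i j = t * entry X a b i j.
Proof. by rewrite /entry mxE. Qed.

Lemma entry_sum (P : pred 'I_N) (F : 'I_N -> 'M[K]_(N * N)) a b i j :
  entry (\sum_(x | P x) F x) a b i j = \sum_x entry (F x) a b i j *+ P x.
Proof.
rewrite /entry summxE big_mkcond; apply: eq_bigr => x _.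
by case: (P x).
Qed.

Lemma entry_diag (P : pred 'I_N) a b i j :
  entry (\sum_(x | P x) E x x *t E x x) a b i j
  = (P a && (b == a))%:R *+ ((i == b) && (j == a)).
Proof.
rewrite entry_sum (sum_pick (t := a)) => [|x xa]; rewrite entry_delta.
  case: (eqVneq b a) => [->|_]; rewrite ?andbF ?mul0rn // eqxx /=.
  by case: (P a); case: (i == a); case: (j == a).
by rewrite eq_sym (negPf xa) mul0rn.
Qed.

Lemma entry_permA (P : 'I_N -> 'I_N -> bool) a b i j :
  entry (\sum_x \sum_(y | P x y) E x y *t E y x) a b i j
  = (P a b)%:R *+ ((i == b) && (j == a)).
Proof.
rewrite entry_sum (sum_pick (t := a)) => [|x xa]; rewrite entry_sum.
  rewrite (sum_pick (t := b)) => [|y yb]; rewrite entry_delta eqxx /=.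
    by case: (P a b); rewrite eqxx /= ?mulr0n ?mul0rn.
  by rewrite [b == y]eq_sym (negPf yb) andbF mul0rn.
rewrite big1 // => y _.
by rewrite entry_delta eq_sym (negPf xa) mul0rn.
Qed.

Lemma entry_permB (P : 'I_N -> 'I_N -> bool) a b i j :
  entry (\sum_x \sum_(y | P x y) E y x *t E x y) a b i j
  = (P b a)%:R *+ ((i == b) && (j == a)).
Proof.
rewrite entry_sum (sum_pick (t := b)) => [|x xb]; rewrite entry_sum.
  rewrite (sum_pick (t := a)) => [|y ya]; rewrite entry_delta.
    by case: (P b a); rewrite !eqxx /= ?mulr0n ?mul0rn.
  by rewrite [a == y]eq_sym (negPf ya) mul0rn.
rewrite big1 // => y _.
by rewrite entry_delta [b == x]eq_sym (negPf xb) !andbF mul0rn.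
Qed.

Lemma entry_mid (P : pred 'I_N) a b i j :
  entry (\sum_(x | P x) (E x m *t E m x + E m x *t E x m)) a b i j
  = ((P a && (b == m))%:R + (P b && (a == m))%:R) *+ ((i == b) && (j == a)).
Proof.
rewrite entry_sum; under eq_bigr => x _ do rewrite entryD !entry_delta mulrnDl.
rewrite big_split (sum_pick (t := a)) => [|x xa] /=; last first.
  by rewrite eq_sym (negPf xa) mul0rn.
rewrite (sum_pick (t := b)) => [|x xb]; last first.
  by rewrite [b == x]eq_sym (negPf xb) !andbF mul0rn.
rewrite !eqxx /= mulrnDl; congr (_ + _).
  case: (eqVneq b m) => [->|_]; rewrite ?andbF ?mul0rn //.
  by case: (P a); case: (i == m); case: (j == a).
case: (eqVneq a m) => [->|_]; rewrite ?andbF ?mul0rn //.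
by case: (P b); case: (i == b); case: (j == m).
Qed.

Lemma entry_opp (P : pred 'I_N) a b i j :
  entry (\sum_(x | P x) E x^' x *t E x x^') a b i j
  = (P b && (a == b^'))%:R *+ ((i == b) && (j == a)).
Proof.
rewrite entry_sum (sum_pick (t := b)) => [|x xb]; rewrite entry_delta.
  case: (eqVneq a b^') => [->|_]; rewrite ?andbF ?mul0rn // eqxx /=.
  by case: (P b); case: (i == b); case: (j == b^').
by rewrite [b == x]eq_sym (negPf xb) !andbF mul0rn.
Qed.

Lemma entry_id a b i j :
  entry (\sum_(x < N) \sum_(y < N | (y < x)%N) E x x *t E y y) a b i j
  = ([&& i == a, j == b & (b < a)%N])%:R.
Proof.
rewrite entry_sum (sum_pick (t := a)) => [|x xa]; rewrite entry_sum.
  rewrite (sum_pick (t := b)) => [|y yb]; rewrite entry_delta.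
    by rewrite !eqxx /=; case: ltnP; case: (i == a); case: (j == b).
  by rewrite [b == y]eq_sym (negPf yb) !andbF mul0rn.
rewrite big1 // => y _.
by rewrite entry_delta eq_sym (negPf xa) mul0rn.
Qed.

Lemma entry_cup (c : 'I_N -> 'I_N -> K) a b i j :
  entry (\sum_(x < N) \sum_(y < N | (y < x)%N) c x y *: (E x y^' *t E x^' y)) a b i j
  = c a j *+ [&& b == a^', i == j^' & (j < a)%N].
Proof.
rewrite entry_sum (sum_pick (t := a)) => [|x xa]; rewrite entry_sum.
  rewrite (sum_pick (t := j)) => [|y yb]; rewrite entryZ entry_delta.
    rewrite !eqxx andbT /=.
    by case: ltnP; case: (i == _); case: (b == _); rewrite /= ?mulr1 ?mulr0 ?mul0rn.
  by rewrite [j == y]eq_sym (negPf yb) !andbF mulr0 mul0rn.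
rewrite big1 // => y _.
by rewrite entryZ entry_delta eq_sym (negPf xa) mulr0 mul0rn.
Qed.

(* Decides which of r^-1 s^-1 and r s is the coefficient of E a b *t E b a. *)
Definition low_pair a b : bool := in_A n a.+1 b.+1 || in_B n b.+1 a.+1.

(** All the terms of [Rmat] proportional to E a b *t E b a, gathered into one coefficient. *)
Definition so_weight a b : K :=
  if a == b then (if a == m then 1 else q)
  else if b == a^' then q^-1
  else if (a == m) || (b == m) then 1
  else if low_pair a b then r^-1 * s^-1 else r * s.

(** This is q^(rho_a): the base is a square root of q and the exponent is 2 rho_a. *)
Definition so_height a : K :=
  (sr^-1 * ss) ^ (double_rho n a.+1).

Lemma eq_mid a : (a == a^') = (a == m).
Proof. rewrite -!val_eqE /= val_rev_ord; have := ltn_ord a; lia. Qed.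

Lemma double_rho_rev a : double_rho n (a^').+1 = - double_rho n a.+1.
Proof.
rewrite /double_rho /prime_index val_rev_ord; have := ltn_ord a.
(repeat case: ifP); lia.
Qed.

(** Each of A and B consists of two families; those of B come with the two indices exchanged. *)
Lemma low_pairE a b : low_pair a b =
  [|| (a < b)%N && (b < n)%N, (a < n)%N && (a^' < b)%N,
      (n < a)%N && (a < b^')%N | (n < b)%N && (b < a)%N].
Proof.
have := ltn_ord a; have := ltn_ord b.
rewrite !val_rev_ord => bN aN; rewrite /low_pair /in_A /in_B /prime_index -orbA.
congr (_ || (_ || (_ || _))); lia.
Qed.

Lemma low_pairR a b :
  (in_A n a.+1 b.+1)%:R + (in_B n b.+1 a.+1)%:R = (low_pair a b)%:R :> K.
Proof.
rewrite /low_pair; case: (boolP (in_A _ _ _)) => [abA|_]; last by rewrite add0r.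
rewrite (_ : in_B _ _ _ = false) ?addr0 //; move: abA.
rewrite /in_A /in_B /prime_index.
have := ltn_ord a; have := ltn_ord b; lia.
Qed.

Lemma eq_rev a b : (a == b^') = (b == a^').
Proof. by apply/eqP/eqP => ->; rewrite rev_ordK. Qed.

(** A and the transpose of B together contain exactly one of (a, b) and (b, a), so r^-1 s^-1 and r s
    occur in inverse pairs. *)
Lemma low_pair_excl a b : a != b -> b != a^' -> a != m -> b != m ->
  low_pair a b = ~~ low_pair b a.
Proof.
rewrite !low_pairE -!val_eqE /= !val_rev_ord.
have := ltn_ord a; have := ltn_ord b.
case: (ltngtP a n) => an; case: (ltngtP b n) => bn //=; lia.
Qed.

Lemma low_pair_revl a b : a != b -> b != a^' -> a != m -> b != m ->
  low_pair a^' b = low_pair b a.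
Proof.
rewrite !low_pairE -!val_eqE /= !val_rev_ord.
have := ltn_ord a; have := ltn_ord b.
case: (ltngtP a n) => an; case: (ltngtP b n) => bn //=; lia.
Qed.

Lemma low_pair_revr a b : a != b -> b != a^' -> a != m -> b != m ->
  low_pair a b^' = low_pair b a.
Proof.
rewrite !low_pairE -!val_eqE /= !val_rev_ord.
have := ltn_ord a; have := ltn_ord b.
case: (ltngtP a n) => an; case: (ltngtP b n) => bn //=; lia.
Qed.

Lemma low_pair_mid a b : (a == m) || (b == m) -> low_pair a b = false.
Proof.
rewrite low_pairE -!val_eqE /= !val_rev_ord.
have := ltn_ord a; have := ltn_ord b; lia.
Qed.

Lemma low_pair_diag a b : (a == b) || (b == a^') -> low_pair a b = false.
Proof.
rewrite low_pairE -!val_eqE /= !val_rev_ord.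
have := ltn_ord a; have := ltn_ord b; lia.
Qed.

Hypothesis n_gt0 : (0 < n)%N.
Hypothesis r_neq0 : r != 0.
Hypothesis s_neq0 : s != 0.
Hypothesis sr_def : sr ^+ 2 = r.
Hypothesis ss_def : ss ^+ 2 = s.

Let u_neq0 : sr^-1 * ss != 0.
Proof.
rewrite mulf_neq0 ?invr_eq0 //.
  by apply: contraNneq r_neq0 => sr0; rewrite -sr_def sr0 expr0n.
by apply: contraNneq s_neq0 => ss0; rewrite -ss_def ss0 expr0n.
Qed.

Let q_neq0 : q != 0.
Proof. by rewrite mulf_neq0 ?invr_eq0. Qed.

Lemma Rmat_entry a b i j :
  entry (Rmat n r s sr ss) a b i j = brR_entry q so_height so_weight a b i j.
Proof.
rewrite /Rmat !entryD !entryZ !entryD -scaleN1r entryZ entry_diag !entry_permA.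
rewrite !entry_permB entry_mid entry_opp entry_id entry_cup entry_delta.
have qV : r / s = q^-1 by rewrite invfM invrK.
rewrite qV /brR_entry !eq_mid.
(* Here rho_i = - rho_j, so that q^(rho_a - rho_j) = h_a h_i. *)
have -> : q_rho n sr ss a.+1 j.+1 *+ [&& b == a^', i == j^' & (j < a)%N]
    = (so_height a * so_height i) *+ [&& b == a^', i == j^' & (j < a)%N].
  case: (eqVneq i j^') => [->|_]; rewrite ?andbF ?mulr0n //.
  by rewrite /so_height double_rho_rev -expfzDr.
have -> : [&& a == m, i == m, b == m & j == m]%:R
    = ((a == m) && (b == m))%:R *+ ((i == b) && (j == a)) :> K.
  case: (eqVneq a m) => [->|_] /=; last by rewrite mul0rn.
  case: (eqVneq b m) => [->|_] /=; last by rewrite andbF mul0rn.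
  by case: (i == m); case: (j == m).
(* For every pair (a, b) exactly one of the bracketed indicator sums is nonzero. *)
have wE : so_weight a b = q * ((a != m) && (b == a))%:R
    + r^-1 / s * ((in_A n a.+1 b.+1)%:R + (in_B n b.+1 a.+1)%:R)
    + r * s * ((in_A n b.+1 a.+1)%:R + (in_B n a.+1 b.+1)%:R)
    + (((a != m) && (b == m))%:R + ((b != m) && (a == m))%:R)
    + q^-1 * ((b != m) && (a == b^'))%:R + ((a == m) && (b == m))%:R.
  rewrite !low_pairR.
  rewrite /so_weight; case: (eqVneq a b) => [<-|ab].
    rewrite !low_pair_diag ?eqxx // eq_mid.
    by case: (eqVneq a m) => _ /=; ring.
  rewrite [a == b^']eq_rev; case: (eqVneq b a^') ab => [->|abr] ab.
    rewrite !low_pair_diag ?rev_ordK ?eqxx ?orbT //.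
    have am : a != m by rewrite -eq_mid.
    have arm : a^' != m by rewrite -eq_mid rev_ordK eq_sym.
    by rewrite (negPf am) (negPf arm) /=; ring.
  case: ifP => [abm|/negbT/norP [am bm]].
    rewrite !low_pair_mid // 1?orbC //.
    case: (eqVneq a m) abm ab => [->|am] /= abm ab.
      by rewrite eq_sym (negPf ab) /=; ring.
    by rewrite abm /=; ring.
  rewrite (low_pair_excl ab) // (negPf am) (negPf bm) /=.
  by case: (low_pair b a) => /=; ring.
case: [&& i == a, j == b & (b < a)%N]; case: [&& b == a^', i == j^' & (j < a)%N];
  case: (boolP ((i == b) && (j == a))) => _; rewrite ?wE ?mulr0n ?mulr1n; ring.
Qed.

Lemma so_weightP : weight_axioms q so_weight.
Proof.
have wD a b : a != b -> a != b^' -> so_weight a b =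
    if (a == m) || (b == m) then 1
    else if low_pair a b then r^-1 * s^-1 else r * s.
  by move=> ab abr; rewrite /so_weight (negPf ab) -eq_rev (negPf abr).
have revm a : (a^' == m) = (a == m).
  by rewrite -!eq_mid rev_ordK eq_sym.
have opp a b : a != b -> a != b^' ->
    [/\ b != a, b != a^', a^' != b, a^' != b^' & b^' != a^'].
  by rewrite !(inj_eq rev_ord_inj) eq_rev [b == a]eq_sym [a^' == b]eq_sym => -> ->.
split=> [a b ab abr|a b ab abr|a b ab abr|a aa|a aa|a aa].
- have [ba bar _ _ _] := opp a b ab abr; rewrite !wD // orbC.
  case: ifP => [_|/negbT/norP [bm am]]; first by rewrite mulr1.
  rewrite (low_pair_excl ab) //.
  by case: (low_pair b a) => /=; field; rewrite r_neq0 s_neq0.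
- have [ba bar abl abr' _] := opp a b ab abr; rewrite !wD // revm orbC.
  by case: ifP => // /negbT/norP [bm am]; rewrite low_pair_revl.
- have [ba bar abl abr' _] := opp a b ab abr.
  rewrite !wD ?rev_ordK // revm orbC.
  by case: ifP => // /negbT/norP [bm am]; rewrite low_pair_revr.
- by rewrite /so_weight eqxx -eq_mid (negPf aa).
- by rewrite /so_weight (negPf aa) eqxx.
by rewrite /so_weight eqxx -eq_mid -aa eqxx.
Qed.

Lemma so_height_rev a : so_height a * so_height a^' = 1.
Proof. by rewrite /so_height double_rho_rev -expfzDr // subrr expr0z. Qed.

Lemma so_height_sq a : so_height a ^+ 2 = q ^ (double_rho n a.+1).
Proof.
rewrite /so_height [LHS]exprnP exprzAC; congr (_ ^ _).
by rewrite -exprnP exprMn exprVn sr_def ss_def.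
Qed.

(* A primitive of the summand in [so_height_sum]. *)
Let tail (k : nat) : K :=
  (if k == n then 1 else q^-1) * q ^ (double_rho n k.+1)
  + (if (k < n)%N then q - q^-1 else 0).

(** Consecutive rho differ by 1, hence consecutive squared heights by a factor q^2, except that the
    two steps at the middle index change rho by 1/2. *)
Let tail_step (k : nat) : (k < 2 * n)%N ->
  (q - q^-1) * q ^ (double_rho n k.+2) = tail k - tail k.+1.
Proof.
move=> k2n; rewrite /tail.
have step (e f : int) : e = f + 2 -> q ^ e = q ^ f * q ^+ 2.
  by move=> ->; rewrite expfzDr.
have rs0 : (r != 0) && (s != 0) by rewrite r_neq0.
have drm : double_rho n n.+1 = 0 by rewrite /double_rho ltnn eqxx.
have [kn|[kn|kn]] : (k.+1 < n \/ n <= k \/ k.+1 = n)%N by lia.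
- have -> : (k.+1 == n) = false by lia.
  have -> : (k.+1 < n)%N by lia.
  have -> : (k == n) = false by lia.
  have -> : (k < n)%N by lia.
  rewrite (step (double_rho n k.+1) (double_rho n k.+2)).
    by field.
  by rewrite /double_rho !ifT; lia.
- have -> : (k.+1 == n) = false by lia.
  have -> : (k.+1 < n)%N = false by lia.
  case: (eqVneq k n) => [->|kn'].
    rewrite ltnn drm expr0z.
    have -> : double_rho n n.+2 = - 1.
      rewrite /double_rho /prime_index !ifF; lia.
    by rewrite exprN1; field.
  have -> : (k < n)%N = false by lia.
  rewrite (step (double_rho n k.+1) (double_rho n k.+2)).
    by field.
  by rewrite /double_rho /prime_index !ifF; lia.
have -> : (k == n) = false by lia.
have -> : (k < n)%N by lia.
rewrite kn ltnn eqxx drm expr0z.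
have -> : double_rho n n = 1 by rewrite /double_rho leqnn; lia.
by rewrite expr1z; field.
Qed.

(** The sum telescopes. At the last index 2 rho = - (2n - 1), and the weight q^-1 completes the
    boundary value to q^(-2n) = p^-1. *)
Lemma so_height_sum j :
  (q - q^-1) * (\sum_(a < N | (j < a)%N) so_height a ^+ 2)
  = so_weight j j^' * so_height j ^+ 2
    + (if (j < j^')%N then q - q^-1 else 0) - q ^- (2 * n).
Proof.
have -> : so_weight j j^' * so_height j ^+ 2
    + (if (j < j^')%N then q - q^-1 else 0) = tail j.
  rewrite so_height_sq /tail; congr (_ * _ + _).
    rewrite /so_weight eqxx eq_mid.
    have -> : (j == m) = (nat_of_ord j == n) by rewrite -val_eqE.
    by case: (_ == _).
  have -> : (j < j^')%N = (j < n)%N by rewrite val_rev_ord; have := ltn_ord j; lia.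
  by [].
have -> : q ^- (2 * n) = tail (2 * n).
  rewrite /tail; have -> : (2 * n == n)%N = false by lia.
  have -> : (2 * n < n)%N = false by lia.
  have -> : double_rho n (2 * n).+1 = - ((2 * n).-1)%:Z.
    by rewrite /double_rho /prime_index !ifF; lia.
  rewrite addr0 exprnN -[q^-1]exprN1 -expfzDr //; congr (_ ^ _); lia.
under eq_bigr do rewrite so_height_sq.
have -> : \sum_(a < N | (j < a)%N) q ^ double_rho n a.+1
    = \sum_(j.+1 <= i < N) q ^ double_rho n i.+1 by rewrite big_geq_mkord.
rewrite mulr_sumr big_add1 /=.
have -> : \sum_(nat_of_ord j <= i < 2 * n) (q - q^-1) * q ^ double_rho n i.+2
    = - \sum_(nat_of_ord j <= i < 2 * n) (tail i.+1 - tail i).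
  rewrite -sumrN; apply: eq_big_nat => i /andP[_ i2n].
  by rewrite opprB tail_step.
by rewrite telescope_sumr ?opprB // -ltnS.
Qed.

End RmatEntries.

(** * Matrices acting in tensor powers *)

Section Similar.
Variable K : fieldType.

(** Equality up to a cast, with the proof of equal dimensions hidden, so that regroupings of tensor
    factors compose. *)
Definition cast_eq m m' (A : 'M[K]_m) (B : 'M[K]_m') : Prop :=
  exists e : m = m', castmx (e, e) A = B.

Lemma cast_eq_refl m (A : 'M[K]_m) : cast_eq A A.
Proof. by exists erefl; rewrite castmx_id. Qed.

Lemma cast_eq_sym m m' (A : 'M[K]_m) (B : 'M[K]_m') : cast_eq A B -> cast_eq B A.
Proof. by case=> e <-; exists (esym e); rewrite castmx_comp castmx_id. Qed.

Lemma cast_eq_trans m1 m2 m3 (A : 'M[K]_m1) (B : 'M[K]_m2) (C : 'M[K]_m3) :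
  cast_eq A B -> cast_eq B C -> cast_eq A C.
Proof.
by case=> e <- [f <-]; exists (etrans e f); rewrite castmx_comp.
Qed.

Lemma cast_eqP m (A B : 'M[K]_m) : cast_eq A B -> A = B.
Proof. by case=> e <-; rewrite (eq_irrelevance e erefl) castmx_id. Qed.

Lemma cast_eq_cast m m' (e : m = m') (A : 'M[K]_m) : cast_eq (castmx (e, e) A) A.
Proof. by apply: cast_eq_sym; exists e. Qed.

Lemma cast_eq_tens m m' p p' (A : 'M[K]_m) (A' : 'M[K]_m')
    (B : 'M[K]_p) (B' : 'M[K]_p') :
  cast_eq A A' -> cast_eq B B' -> cast_eq (A *t B) (A' *t B').
Proof.
case=> e <- [f <-] {A' B'}; case: m' / e; case: p' / f.
by rewrite !castmx_id; apply: cast_eq_refl.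
Qed.

Lemma cast_eq_tensA m n p (A : 'M[K]_m) (B : 'M[K]_n) (C : 'M[K]_p) :
  cast_eq (A *t (B *t C)) (A *t B *t C).
Proof.
exists (mulnA m n p); apply/matrixP => s t; rewrite castmxE.
case: (mxtens_indexP s) => {}s k; case: (mxtens_indexP s) => i j.
case: (mxtens_indexP t) => {}t k'; case: (mxtens_indexP t) => i' j'.
have E x y z : cast_ord (esym (mulnA m n p)) (mxtens_index (mxtens_index (x, y), z))
    = mxtens_index (x, mxtens_index (y, z)).
  by apply: val_inj => /=; rewrite mulnDl mulnA addnA.
by rewrite !E !tensmxE mulrA.
Qed.

Lemma cast_eq1 m m' : m = m' -> cast_eq (1%:M : 'M[K]_m) (1%:M : 'M[K]_m').
Proof. by move=> ->; apply: cast_eq_refl. Qed.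

Lemma cast_eq11 m n p : (m * n = p)%N ->
  cast_eq (1%:M : 'M[K]_p) ((1%:M : 'M[K]_m) *t (1%:M : 'M[K]_n)).
Proof. by move=> <-; rewrite tensmx11; apply: cast_eq_refl. Qed.

End Similar.

Section TwoSite.
Variables (K : fieldType) (N t : nat).
Implicit Types (i j : 'I_t.-1) (X Y : 'M[K]_(N * N)).

Lemma two_siteM i X Y : two_site (X *m Y) i = two_site X i *m two_site Y i.
Proof. by rewrite /two_site -castmxM !tensmx_mul !mulmx1. Qed.

Lemma two_siteD i X Y : two_site (X + Y) i = two_site X i + two_site Y i.
Proof. by rewrite /two_site tensmxDr tensmxDl castmxD. Qed.

Lemma two_siteZ i a X : two_site (a *: X) i = a *: two_site X i.
Proof. by rewrite /two_site tensmxZr tensmxZl castmxZ. Qed.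

Lemma two_siteN i X : two_site (- X) i = - two_site X i.
Proof. by rewrite -scaleN1r two_siteZ scaleN1r. Qed.

Lemma two_site1 i : two_site (1%:M : 'M[K]_(N * N)) i = 1%:M.
Proof. by rewrite /two_site !tensmx11 castmx1. Qed.

Lemma three_site_dim i j : j = i.+1 :> nat ->
  (N ^ i * (N * N * N) * N ^ (t - i.+3) = N ^ t)%N.
Proof.
move=> ji; have := ltn_ord j => jt.
rewrite -[in RHS](_ : i + 3 + (t - i.+3) = t)%N; last by lia.
by rewrite !expnD !expnS expn0 !muln1 !mulnA.
Qed.

(** An operator on three consecutive factors; relations between neighbouring generators are
    transported along it. The index [j] guarantees that the third factor exists. *)
Definition three_site i j (ji : j = i.+1 :> nat) (X : 'M[K]_(N * N * N)) :
    'M[K]_(N ^ t) :=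
  castmx (three_site_dim ji, three_site_dim ji)
    ((1%:M : 'M[K]_(N ^ i)) *t X *t (1%:M : 'M[K]_(N ^ (t - i.+3)))).

Lemma three_siteM i j (ji : j = i.+1 :> nat) (X Y : 'M[K]_(N * N * N)) :
  three_site ji (X *m Y) = three_site ji X *m three_site ji Y.
Proof. by rewrite /three_site -castmxM !tensmx_mul !mulmx1. Qed.

Lemma three_siteZ i j (ji : j = i.+1 :> nat) a (X : 'M[K]_(N * N * N)) :
  three_site ji (a *: X) = a *: three_site ji X.
Proof. by rewrite /three_site tensmxZr tensmxZl castmxZ. Qed.

Lemma three_site1 i j (ji : j = i.+1 :> nat) X :
  three_site ji (site1 X) = two_site X i.
Proof.
apply: cast_eqP; apply: cast_eq_trans (cast_eq_cast _ _) _.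
apply: cast_eq_sym; apply: cast_eq_trans (cast_eq_cast _ _) _.
have split1 : (N * N ^ (t - i.+3) = N ^ (t - i.+2))%N.
  by rewrite -expnS; congr (_ ^ _)%N; have := ltn_ord j; lia.
apply: cast_eq_trans (cast_eq_tens (cast_eq_refl _) (cast_eq11 _ split1)) _.
apply: cast_eq_trans (cast_eq_tensA _ _ _) _.
apply: cast_eq_tens (cast_eq_refl _); apply: cast_eq_sym; exact: cast_eq_tensA.
Qed.

Lemma three_site2 i j (ji : j = i.+1 :> nat) X :
  three_site ji (site2 X) = two_site X j.
Proof.
apply: cast_eqP; apply: cast_eq_trans (cast_eq_cast _ _) _.
apply: cast_eq_sym; apply: cast_eq_trans (cast_eq_cast _ _) _.
apply: cast_eq_tens; last by apply: cast_eq1; rewrite ji.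
have split1 : (N ^ i * N = N ^ j)%N by rewrite ji expnSr.
apply: cast_eq_trans (cast_eq_tens (cast_eq11 _ split1) (cast_eq_refl _)) _.
apply: cast_eq_trans (cast_eq_sym (cast_eq_tensA _ _ _)) _.
apply: cast_eq_tens (cast_eq_refl _) _; apply: cast_eq_sym; exact: cast_eq_cast.
Qed.

(** Both operators are written over one decomposition into five blocks, where each is the identity
    on the block of the other. *)
Lemma two_site_comm i j X Y : (i.+1 < j)%N ->
  two_site X i *m two_site Y j = two_site Y j *m two_site X i.
Proof.
move=> ij; pose d := (j - i.+2)%N; pose c := (t - j.+2)%N.
pose W (X Y : 'M[K]_(N * N)) := (1%:M : 'M[K]_(N ^ i)) *t X
  *t (1%:M : 'M[K]_(N ^ d)) *t Y *t (1%:M : 'M[K]_(N ^ c)).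
have jt := ltn_ord j.
have dim : (N ^ i * (N * N) * N ^ d * (N * N) * N ^ c = N ^ t)%N.
  rewrite mulnn -!expnD; congr (_ ^ _)%N; rewrite /d /c; lia.
have EX : two_site X i = castmx (dim, dim) (W X 1%:M).
  apply: cast_eqP; apply: cast_eq_trans (cast_eq_cast _ _) _.
  apply: cast_eq_sym; apply: cast_eq_trans (cast_eq_cast _ _) _.
  apply: cast_eq_trans (cast_eq_sym (cast_eq_tensA _ _ _)) _.
  apply: cast_eq_trans (cast_eq_sym (cast_eq_tensA _ _ _)) _.
  apply: cast_eq_tens (cast_eq_refl _) _; rewrite !tensmx11; apply: cast_eq1.
  by rewrite mulnn -!expnD; congr (_ ^ _)%N; rewrite /d /c; lia.
have EY : two_site Y j = castmx (dim, dim) (W 1%:M Y).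
  apply: cast_eqP; apply: cast_eq_trans (cast_eq_cast _ _) _.
  apply: cast_eq_sym; apply: cast_eq_trans (cast_eq_cast _ _) _.
  apply: cast_eq_tens (cast_eq_refl _); apply: cast_eq_tens (cast_eq_refl _).
  rewrite !tensmx11; apply: cast_eq1.
  by rewrite mulnn -!expnD; congr (_ ^ _)%N; rewrite /d; lia.
by rewrite EX EY -!castmxM /W !tensmx_mul !mulmx1 !mul1mx.
Qed.

End TwoSite.

(** * Representations of the BWM algebra *)

Section Evaluation.
Variables (K : fieldType) (t m : nat) (p q : K).
Local Notation S := 'M[K]_m.+1.
Variables G V : 'I_t.-1 -> S.

Definition gen_image (x : bool * 'I_t.-1) : S := if x.1 then G x.2 else V x.2.

Definition word_image (u : {fmonom (bool * 'I_t.-1)%type}) : S :=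
  \prod_(x <- (u : seq _)) gen_image x.

Fact word_image_is_mmorphism : mmorphism word_image.
Proof.
by split=> [u v|]; rewrite /word_image (fmM, fm1) ?big_cat ?big_nil.
Qed.

HB.instance Definition _ :=
  isMultiplicative.Build _ _ word_image word_image_is_mmorphism.

Definition free_image (x : bwm_free K t) : S :=
  mmap (@scalar_mx K m.+1) word_image x.

Lemma free_imageD x y : free_image (x + y) = free_image x + free_image y.
Proof. exact: mmapD. Qed.

Lemma free_imageB x y : free_image (x - y) = free_image x - free_image y.
Proof. exact: mmapB. Qed.

Lemma free_imageZ a x : free_image (a *: x) = a *: free_image x.
Proof. by rewrite -mul_scalar_mx; apply: mmapZ. Qed.

(** Coefficients are sent to scalar matrices, which commute with the images of words. *)
Lemma free_image_multiplicative : multiplicative free_image.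
Proof.
by apply: commr_mmap_is_multiplicative => g u v; apply/esym/scalar_mxC.
Qed.

Let free_imageM x y : free_image (x * y) = free_image x * free_image y.
Proof. by case: free_image_multiplicative => fM _; apply: fM. Qed.

Let free_image1 : free_image 1 = 1.
Proof. by case: free_image_multiplicative. Qed.

Lemma free_imageU x : free_image << fmu x >> = gen_image x.
Proof. by rewrite /free_image mmapU mul1r /word_image fmU big_seq1. Qed.

Lemma free_image_g i : free_image (free_g K i) = G i.
Proof. exact: free_imageU. Qed.

Lemma free_image_ginv i : free_image (free_ginv K i) = V i.
Proof. exact: free_imageU. Qed.

Lemma free_image_e i :
  free_image (free_e q i) = 1%:M - (q - q^-1)^-1 *: (G i - V i).
Proof.
rewrite -free_image_g -free_image_ginv -free_imageB -free_imageZ.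
rewrite (_ : 1%:M = free_image 1); last exact/esym/free_image1.
exact: free_imageB.
Qed.

Hypothesis relP : forall x y, bwm_rel p q x y -> free_image x = free_image y.

Lemma free_image_ideal x : bwm_ideal p q x -> free_image x = 0.
Proof.
elim=> {x} [x y xy||x y _ x0 _ y0|a x _ x0|a x _ x0].
- by rewrite free_imageB (relP xy) subrr.
- exact: mmap0.
- by rewrite free_imageD x0 y0 addr0.
- by rewrite free_imageM x0 mulr0.
- by rewrite free_imageM x0 mul0r.
Qed.

Definition bwm_lift (u : bwm t p q) : S := free_image (repr u).

(** The chosen representative differs from [x] by an element of the ideal, which the evaluation
    kills. *)
Lemma bwm_lift_pi x : bwm_lift (bwm_pi p q x) = free_image x.
Proof.
apply/eqP; rewrite -subr_eq0 -free_imageB; apply/eqP.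
exact/free_image_ideal/bwm_repr.
Qed.

Fact bwm_lift_is_zmod_morphism : zmod_morphism bwm_lift.
Proof.
have liftD u v : bwm_lift (u + v) = bwm_lift u + bwm_lift v.
  rewrite -[u]bwm_piK -[v]bwm_piK -bwm_pi_is_additive !bwm_lift_pi.
  exact: free_imageD.
by move=> u v; have := liftD (u - v) v; rewrite subrK => ->; rewrite addrK.
Qed.

Fact bwm_lift_is_monoid_morphism : monoid_morphism bwm_lift.
Proof.
split=> [|u v].
  by rewrite [1]/(bwm_pi p q 1) bwm_lift_pi free_image1.
rewrite -[u]bwm_piK -[v]bwm_piK.
by rewrite -bwm_pi_is_multiplicative !bwm_lift_pi free_imageM.
Qed.

HB.instance Definition _ :=
  GRing.isZmodMorphism.Build _ _ bwm_lift bwm_lift_is_zmod_morphism.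
HB.instance Definition _ :=
  GRing.isMonoidMorphism.Build _ _ bwm_lift bwm_lift_is_monoid_morphism.

Lemma bwm_lift_scalable : scalable bwm_lift.
Proof.
move=> a u; rewrite -[u]bwm_piK -bwm_pi_is_scalable !bwm_lift_pi.
exact: free_imageZ.
Qed.

Lemma bwm_lift_exists : exists pi : {rmorphism bwm t p q -> S},
  scalable pi /\ forall i, pi (bwm_g _ _ i) = G i.
Proof.
exists bwm_lift; split; first exact: bwm_lift_scalable.
by move=> i; apply: etrans (bwm_lift_pi _) (free_image_g i).
Qed.

End Evaluation.

(* [d] is positive because ['M_d] is a nontrivial ring, as the evaluation of
   free monoid algebras requires, only for [d] a successor. *)
Lemma bwm_universal (K : fieldType) (t d : nat) (p q : K)
    (G V E : 'I_t.-1 -> 'M[K]_d) :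
  (0 < d)%N ->
  (forall i, E i = 1%:M - (q - q^-1)^-1 *: (G i - V i)) ->
  (forall i, G i *m V i = 1%:M) -> (forall i, V i *m G i = 1%:M) ->
  (forall i j : 'I_t.-1, j = i.+1 :> nat ->
    G i *m G j *m G i = G j *m G i *m G j) ->
  (forall i j : 'I_t.-1, (i.+1 < j)%N -> G i *m G j = G j *m G i) ->
  (forall i, E i *m G i = p^-1 *: E i) ->
  (forall i j : 'I_t.-1, i = j.+1 :> nat ->
    E i *m G j *m E i = p *: E i /\ E i *m V j *m E i = p^-1 *: E i) ->
  exists pi : {rmorphism bwm t p q -> 'M[K]_d},
    scalable pi /\ forall i, pi (bwm_g _ _ i) = G i.
Proof.
case: d G V E => // m G V E _ defE GV VG braid far EG EGE.
have relP x y : bwm_rel p q x y -> free_image G V x = free_image G V y.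
  have [M one] := free_image_multiplicative G V.
  have gE := free_image_g G V; have vE := free_image_ginv G V.
  have eE i : free_image G V (free_e q i) = E i by rewrite defE free_image_e.
  have fM a b A B : free_image G V a = A -> free_image G V b = B ->
      free_image G V (a * b) = A *m B by move=> <- <-; apply: M.
  have fZ c a A : free_image G V a = A -> free_image G V (c *: a) = c *: A.
    by move=> <-; apply: free_imageZ.
  case=> [i|i|i j ij|i j ij|i|i j ij|i j ij].
  - exact: etrans (fM _ _ _ _ (gE i) (vE i)) (etrans (GV i) (esym one)).
  - exact: etrans (fM _ _ _ _ (vE i) (gE i)) (etrans (VG i) (esym one)).
  - apply: etrans (fM _ _ _ _ (fM _ _ _ _ (gE i) (gE j)) (gE i)) _.
    apply: etrans (braid i j ij) (esym _).
    exact: (fM _ _ _ _ (fM _ _ _ _ (gE j) (gE i)) (gE j)).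
  - apply: etrans (fM _ _ _ _ (gE i) (gE j)) _.
    apply: etrans (esym (fM _ _ _ _ (gE j) (gE i))).
    by case/orP: ij => ij; [exact: far | exact/esym/far].
  - apply: etrans (fM _ _ _ _ (eE i) (gE i)) _.
    exact: etrans (EG i) (esym (fZ _ _ _ (eE i))).
  - apply: etrans (fM _ _ _ _ (fM _ _ _ _ (eE i) (gE j)) (eE i)) _.
    exact: etrans (EGE i j ij).1 (esym (fZ _ _ _ (eE i))).
  - apply: etrans (fM _ _ _ _ (fM _ _ _ _ (eE i) (vE j)) (eE i)) _.
    exact: etrans (EGE i j ij).2 (esym (fZ _ _ _ (eE i))).
exact: (bwm_lift_exists relP).
Qed.

(** * Distinct monomials in algebraically independent elements *)

Section AlgIndepConsequences.
Import mpoly.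
Variables (K : fieldType) (x y : K).
Hypothesis xy : alg_indep2 x y.

Let val2 := tnth [tuple x; y].

(** As [f] is an arbitrary map on coefficients, the value is read off from the support of the
    binomial. *)
Lemma mmap_binomial (f : rat -> K) (m0 m1 : 'X_{1..2}) : m0 != m1 ->
  mmap f val2 ('X_[m0] - 'X_[m1])
  = f 1 * mmap1 val2 m0 + f (- 1) * mmap1 val2 m1.
Proof.
move=> m01; rewrite /mmap (perm_big [:: m0; m1]) /=.
  rewrite big_cons big_seq1 !mcoeffB !mcoeffX !eqxx.
  by rewrite (negPf m01) [m1 == m0]eq_sym (negPf m01) subr0 sub0r.
apply: uniq_perm; rewrite ?msupp_uniq //= ?inE ?m01 // => m.
rewrite mcoeff_msupp mcoeffB !mcoeffX !inE ![_ == m]eq_sym.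
case: (eqVneq m m0) => [->|_]; first by rewrite (negPf m01).
by case: (eqVneq m m1).
Qed.

Lemma alg_indep2_neq (m0 m1 : 'X_{1..2}) : m0 != m1 ->
  mmap1 val2 m0 != mmap1 val2 m1.
Proof.
move=> m01; apply/negP => /eqP E.
have : 'X_[m0] - 'X_[m1] = 0 :> mpoly 2 rat.
  apply: xy; rewrite mmap_binomial // E -mulrDl.
  suff -> : @ratr K 1 + ratr (- 1) = 0 by rewrite mul0r.
  by rewrite /ratr /= !divr1 subrr.
move/(congr1 (mcoeff m0)); rewrite mcoeffB !mcoeffX eqxx eq_sym (negPf m01).
by rewrite mcoeff0 subr0 => /eqP; rewrite oner_eq0.
Qed.

Lemma alg_indep2_monomials (a b c d : nat) : (a, b) != (c, d) ->
  x ^+ a * y ^+ b != x ^+ c * y ^+ d.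
Proof.
pose mon (u v : nat) : 'X_{1..2} := [multinom nth 0%N [:: u; v] i | i < 2].
have monE u v : mmap1 val2 (mon u v) = x ^+ u * y ^+ v.
  by rewrite /mmap1 big_ord_recl big_ord1 !mnmE /val2 !(tnth_nth 0).
move=> abcd; rewrite -!monE; apply: alg_indep2_neq.
apply: contraNneq abcd => /mnmP E; apply/eqP.
by have := E ord0; have := E (lift ord0 ord0); rewrite !mnmE /= => -> ->.
Qed.

End AlgIndepConsequences.

(** * The representation given by the type B matrix *)

Lemma Rmat_brR n (K : fieldType) (r s sr ss : K) :
  r != 0 -> s != 0 -> sr ^+ 2 = r -> ss ^+ 2 = s ->
  Rmat n r s sr ss
  = brR (r^-1 * s) (@so_height n K sr ss) (@so_weight n K r s).
Proof.
move=> r0 s0 srE ssE; apply/matrixP => u v.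
case: (mxtens_indexP u) => a b; case: (mxtens_indexP v) => i j.
have := Rmat_entry r0 s0 srE ssE a b i j; rewrite /entry => ->.
by rewrite -entryE.
Qed.

Theorem proposition3p21 (n t : nat) (K : fieldType) (r s sr ss : K)
    (n_ge2 : (2 <= n)%N) (t_ge2 : (2 <= t)%N)
    (K_char0 : [pchar K]%R =i pred0) (rs_indep : alg_indep2 r s)
    (sr_def : sr ^+ 2 = r) (ss_def : ss ^+ 2 = s) :
  exists pi : {rmorphism bwm t (r ^- (2 * n) * s ^+ (2 * n)) (r^-1 * s)
                         -> 'M[K]_((2 * n).+1 ^ t)},
    scalable pi /\
    forall i : 'I_t.-1, pi (bwm_g _ _ i) = two_site (Rmat n r s sr ss) i.
Proof.
have r0 : r != 0.
  (* Independence gives r != r^2, which excludes r = 0. *)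
  have := @alg_indep2_monomials _ _ _ rs_indep 1 0 2 0 isT.
  by apply: contraNneq => ->; rewrite !expr0n !mul0r.
have s0 : s != 0.
  have := @alg_indep2_monomials _ _ _ rs_indep 0 1 0 2 isT.
  by apply: contraNneq => ->; rewrite !expr0n !mulr0.
have rs : r ^+ 2 != s ^+ 2.
  by have := @alg_indep2_monomials _ _ _ rs_indep 2 0 0 2 isT; rewrite mulr1 mul1r.
set q := r^-1 * s.
have q0 : q != 0 by rewrite mulf_neq0 ?invr_eq0.
have n_gt0 : (0 < n)%N by apply: leq_trans n_ge2.
(* If q^2 = 1, then s = r q would give s^2 = r^2. *)
have lam0 : q - q^-1 != 0.
  apply: contra rs; rewrite subr_eq0 => /eqP qV.
  have q2 : q ^+ 2 = 1 by rewrite expr2 {2}qV mulfV.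
  have -> : s = r * q by rewrite /q mulVKf.
  by rewrite exprMn q2 mulr1.
have pE : r ^- (2 * n) * s ^+ (2 * n) = q ^+ (2 * n).
  by rewrite /q exprMn exprVn.
set p := r ^- (2 * n) * s ^+ (2 * n).
pose h := @so_height n K sr ss; pose w := @so_weight n K r s.
pose Rm := brR q h w; pose Vm := brV q h w; pose Km := brK h.
have h_rev : forall a, h a * h (rev_ord a) = 1 := so_height_rev r0 s0 sr_def ss_def.
have W : weight_axioms q w := so_weightP n r0 s0.
have h_sum := so_height_sum n_gt0 r0 s0 sr_def ss_def.
have pV : q ^- (2 * n) = p^-1 by rewrite /p pE.
rewrite pV in h_sum.
have p0 : p != 0 by rewrite /p pE expf_neq0.
have RmE : Rmat n r s sr ss = Rm by apply: Rmat_brR.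
(* By the definition of V, this identifies K with the image of the e_i of the algebra. *)
have KmE : Km = 1%:M - (q - q^-1)^-1 *: (Rm - Vm).
  rewrite /Vm /brV opprD opprB addrA addrCA subrr addr0 scalerBr !scalerA.
  by rewrite mulVf // !scale1r opprB addrC subrK.
rewrite RmE; apply: (@bwm_universal K t ((2 * n).+1 ^ t) p q
  (two_site Rm) (two_site Vm) (two_site Km)) => [|i|i|i|i j ij|i j ij|i|i j ij].
- by rewrite expn_gt0.
- by rewrite KmE two_siteD two_siteN two_siteZ two_siteD two_siteN two_site1.
- by rewrite -two_siteM (brR_brV q0 h_rev W h_sum) two_site1.
- by rewrite -two_siteM (brV_brR q0 h_rev W h_sum) two_site1.
- rewrite -!(three_site1 ij) -!(three_site2 ij) -!three_siteM.
  by rewrite (braid_eq q0 h_rev W h_sum).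
- exact: two_site_comm.
- by rewrite -two_siteM (brK_brR h_rev h_sum) two_siteZ.
(* Here i = j + 1: the generator of index j acts on the first two of the three factors, and e_i on
   the last two. *)
rewrite -!(three_site1 ij) -!(three_site2 ij) -!three_siteM.
rewrite (cap_site1_cup q0 h_rev W h_sum (p := p)) ?mulfV //.
by rewrite (cap_site1V_cup q0 h_rev W h_sum) !three_siteZ.
Qed.
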